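(* Let $(M,\mathsf{g})$ be a compact oriented Riemannian 2-manifold, possibly with boundary, and suppose that $(M,\mathsf{g})$ is flat. Let $R$ be an orthogonal reflection map on $M$ with associated isomorphism $\flat:\mathfrak{X}(M)\to\Omega^1(M)$, $\xi\mapsto\xi^\flat=\mathsf{g}(R\xi,\cdot)$. Then $$\mathfrak{X}_{\mathrm{con}}(M)^\flat=\mathcal{H}^1(M),$$ i.e. the image of the space of conformal vector fields under $\flat$ is exactly the space of harmonic 1-fields.
   Context: $\mathfrak{X}(M)$ is the space of smooth vector fields on $M$, $\Omega^k(M)$ the smooth $k$-forms, and $\mathcal{F}(M)$ the smooth real-valued functions (all smooth up to the boundary, no boundary conditions). Conformal vector fields: $\mathfrak{X}_{\mathrm{con}}(M)=\{\xi\in\mathfrak{X}(M): \mathcal{L}_\xi\mathsf{g}=F\mathsf{g}\text{ for some }F\in\mathcal{F}(M)\}$, where $\mathcal{L}$ is the Lie derivative. Harmonic 1-fields: $\mathcal{H}^1(M)=\{\alpha\in\Omega^1(M): d\alpha=0,\ \delta\alpha=0\}$, where $\delta:\Omega^1(M)\to\Omega^0(M)$ is the codifferential (equal up to sign to $\star d\star$, with $\star$ the Hodge star of $\mathsf{g}$). Orthogonal reflection map: a smooth $(1,1)$-tensor field $R$ on $M$, regarded as a fibrewise linear map $TM\to TM$, which is an orientation-reversing fibrewise isometry with $R^2=\mathrm{Id}$, such that around every point there are local coordinates $(x,y)$ with $\mathsf{g}=dx\otimes dx+dy\otimes dy$ and $R=dx\otimes\partial_x-dy\otimes\partial_y$ (i.e.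 $R(u\partial_x+v\partial_y)=u\partial_x-v\partial_y$). *)

(* Defs.v *)
From mathcomp Require Import all_boot all_order all_algebra.
From mathcomp Require Import all_classical all_reals all_analysis.

Set Implicit Arguments.
Unset Strict Implicit.
Unset Printing Implicit Defensive.

Import Order.TTheory GRing.Theory Num.Theory.
Import numFieldNormedType.Exports.

Local Open Scope classical_set_scope.
Local Open Scope ring_scope.

Section HalfPlane.
Variable R : realType.

(* Points of the plane are row vectors, with coordinates p 0 0 and p 0 1. *)
Definition basis_vec (i : 'I_2) : 'rV[R]_2 := delta_mx 0 i.

Definition half_plane : set 'rV[R]_2 := [set p | 0 <= p 0 1].

Fixpoint Ck (k : nat) (V : set 'rV[R]_2) (f : 'rV[R]_2 -> R) : Prop :=
  match k with
  | 0%N => forall p, V p -> {for p, continuous f}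
  | k'.+1 => (forall p, V p -> differentiable f p) /\
             forall i, Ck k' V ('D_(basis_vec i) f)
  end.

(* Smoothness on a set A that need not be open: local smooth extendability. *)
Definition smooth_on (A : set 'rV[R]_2) (f : 'rV[R]_2 -> R) : Prop :=
  forall p, A p -> exists (V : set 'rV[R]_2) (h : 'rV[R]_2 -> R),
    [/\ open V, V p, forall k, Ck k V h & forall q, A q -> V q -> f q = h q].

(* The increments t are restricted to those staying in the half-plane, so this
   is the usual partial derivative at interior points, and the normal
   derivative (i = 1) is one-sided at points of the boundary line. *)
Definition partial (i : 'I_2) (f : 'rV[R]_2 -> R) (q : 'rV[R]_2) : R :=
  lim ((fun t : R => t^-1 * (f (q + t *: basis_vec i) - f q)) @
       within [set t | half_plane (q + t *: basis_vec i)] 0^').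

End HalfPlane.

Section Surface.
Variables (R : realType) (M : topologicalType).

(* A homeomorphism from an open subset of M onto a relatively open subset of
   the half-plane; the values of [coord] and [pt] elsewhere are irrelevant. *)
Record chart := Chart {
  dom : set M;
  coord : M -> 'rV[R]_2;
  pt : 'rV[R]_2 -> M;
  dom_open : open dom;
  coord_dom : exists2 V : set 'rV[R]_2,
        open V & coord @` dom = V `&` half_plane (R:=R);
  coordK : forall p, dom p -> pt (coord p) = p;
  coord_continuous : {within dom, continuous coord};
  pt_continuous : {within coord @` dom, continuous pt} }.

Definition smooth_in (c : chart) (U : set M) (f : M -> R) : Prop :=
  smooth_on (coord c @` (U `&` dom c)) (f \o pt c).

(* A smooth 2-manifold with (possibly empty) boundary.  The atlas need not be
   maximal.  [chart_at p] is a preferred chart around p, used only to represent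
   tensors at p. *)
Record surface := Surface {
  atlas : set chart;
  chart_at : M -> chart;
  chart_at_atlas : forall p, atlas (chart_at p);
  chart_at_dom : forall p, dom (chart_at p) p;
  transition_smooth : forall a c, atlas a -> atlas c ->
        forall i, smooth_in a (dom c) (fun p => coord c p 0 i);
  surface_hausdorff : hausdorff_space M;
  surface_second_countable : @second_countable M }.

(* The derivative at p of f with respect to the i-th coordinate of c. *)
Definition pd (c : chart) (i : 'I_2) (f : M -> R) (p : M) : R :=
  partial i (f \o pt c) (coord c p).

(* The Jacobian matrix at p of the transition map from a to c. *)
Definition Jac (a c : chart) (p : M) : 'M[R]_2 :=
  \matrix_(i, j) pd a j (fun q => coord c q 0 i) p.

Variable S : surface.

Definition oriented : Prop := forall a c p,
  atlas S a -> atlas S c -> dom a p -> dom c p -> 0 < \det (Jac a c p).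

(* The tangent space at p is identified with the column vectors through the
   coordinate basis of chart_at S p.  Accordingly a vector field is a function
   M -> 'cV[R]_2, a 1-form a function M -> 'rV[R]_2, a symmetric (0,2)-tensor
   field a function M -> 'M[R]_2 (its Gram matrix) and a (1,1)-tensor field a
   function M -> 'M[R]_2 (acting on column vectors).  The functions below give
   the components in an arbitrary chart c of the atlas around p. *)
Definition to_chart (c : chart) (p : M) : 'M[R]_2 := Jac (chart_at S p) c p.
Definition from_chart (c : chart) (p : M) : 'M[R]_2 := Jac c (chart_at S p) p.

Definition vec_in (c : chart) (xi : M -> 'cV[R]_2) (p : M) : 'cV[R]_2 :=
  to_chart c p *m xi p.
Definition form_in (c : chart) (a : M -> 'rV[R]_2) (p : M) : 'rV[R]_2 :=
  a p *m from_chart c p.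
Definition bilin_in (c : chart) (g : M -> 'M[R]_2) (p : M) : 'M[R]_2 :=
  (from_chart c p)^T *m g p *m from_chart c p.
Definition endo_in (c : chart) (T : M -> 'M[R]_2) (p : M) : 'M[R]_2 :=
  to_chart c p *m T p *m from_chart c p.

Definition smooth_function (f : M -> R) : Prop :=
  forall c, atlas S c -> smooth_in c setT f.
Definition vector_fields : set (M -> 'cV[R]_2) :=
  [set xi | forall c i, atlas S c ->
     smooth_in c setT (fun p => vec_in c xi p i 0)].
Definition one_forms : set (M -> 'rV[R]_2) :=
  [set a | forall c i, atlas S c ->
     smooth_in c setT (fun p => form_in c a p 0 i)].

Definition riemannian_metric (g : M -> 'M[R]_2) : Prop :=
  [/\ forall p, (g p)^T = g p,
      forall p (v : 'cV[R]_2), v != 0 -> 0 < (v^T *m g p *m v) 0 0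
    & forall c i j, atlas S c ->
        smooth_in c setT (fun p => bilin_in c g p i j)].

(* Gamma^k_{ij} in the chart c *)
Definition christoffel (g : M -> 'M[R]_2) (c : chart) (k i j : 'I_2) (p : M)
    : R :=
  2^-1 * \sum_l invmx (bilin_in c g p) k l *
    (pd c i (fun q => bilin_in c g q j l) p
     + pd c j (fun q => bilin_in c g q i l) p
     - pd c l (fun q => bilin_in c g q i j) p).

(* R^l_{kij} in the chart c, i.e. the l-th component of
   R(partial_i, partial_j) partial_k *)
Definition riemann_curvature (g : M -> 'M[R]_2) (c : chart)
    (l k i j : 'I_2) (p : M) : R :=
  pd c i (christoffel g c l j k) p - pd c j (christoffel g c l i k) p
  + \sum_m (christoffel g c l i m p * christoffel g c m j k p
            - christoffel g c l j m p * christoffel g c m i k p).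

Definition flat (g : M -> 'M[R]_2) : Prop :=
  forall c l k i j p, atlas S c -> dom c p ->
    riemann_curvature g c l k i j p = 0.

(* The components (L_xi g)_{ij} in the chart c. *)
Definition lie_metric (g : M -> 'M[R]_2) (xi : M -> 'cV[R]_2) (c : chart)
    (p : M) : 'M[R]_2 :=
  \matrix_(i, j) \sum_k
    (vec_in c xi p k 0 * pd c k (fun q => bilin_in c g q i j) p
     + bilin_in c g p k j * pd c i (fun q => vec_in c xi q k 0) p
     + bilin_in c g p i k * pd c j (fun q => vec_in c xi q k 0) p).

Definition conformal_fields (g : M -> 'M[R]_2) : set (M -> 'cV[R]_2) :=
  [set xi | vector_fields xi /\
     exists2 F : M -> R, smooth_function F &
       forall c p, atlas S c -> dom c p ->
         lie_metric g xi c p = F p *: bilin_in c g p].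

(* The coefficient of dx^0 /\ dx^1 in d a, in the chart c. *)
Definition ext_deriv (c : chart) (a : M -> 'rV[R]_2) (p : M) : R :=
  pd c 0 (fun q => form_in c a q 0 1) p - pd c 1 (fun q => form_in c a q 0 0) p.

(* (star a)_j = sqrt (det g) sum_(i,k) g^{ik} a_k eps_{ij}, with v^i = g^{ik} a_k;
   equivalently b /\ star a = g(b,a) vol with vol = sqrt (det g) dx^0 /\ dx^1.
   The formula is stated in the chart chart_at S p, which is positive when S is
   oriented. *)
Definition hodge1 (g : M -> 'M[R]_2) (a : M -> 'rV[R]_2) (p : M) : 'rV[R]_2 :=
  let v : 'cV[R]_2 := invmx (g p) *m (a p)^T in
  Num.sqrt (\det (g p)) *: \row_j (if j == 0 then - v 1 0 else v 0 0).

(* The Hodge star of the 2-form b dx^0 /\ dx^1 in a positive chart c. *)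
Definition hodge2 (g : M -> 'M[R]_2) (c : chart) (b : R) (p : M) : R :=
  b / Num.sqrt (\det (bilin_in c g p)).

(* delta = - star d star on 1-forms in dimension 2 *)
Definition codiff (g : M -> 'M[R]_2) (c : chart) (a : M -> 'rV[R]_2) (p : M)
    : R :=
  - hodge2 g c (ext_deriv c (hodge1 g a) p) p.

Definition harmonic_1fields (g : M -> 'M[R]_2) : set (M -> 'rV[R]_2) :=
  [set a | one_forms a /\
     forall c p, atlas S c -> dom c p ->
       ext_deriv c a p = 0 /\ codiff g c a p = 0].

(* The components of d f in the chart c. *)
Definition differential (c : chart) (f : M -> R) (p : M) : 'rV[R]_2 :=
  \row_j pd c j f p.

(* Rows: the components of dx and dy in the chart c.  The columns of its
   inverse are then the components of partial_x and partial_y. *)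
Definition coframe (c : chart) (x y : M -> R) (p : M) : 'M[R]_2 :=
  \matrix_i (if i == 0 then differential c x p else differential c y p).

(* Local coordinates (x,y) on U take values in the plane rather than in the
   half-plane: at a boundary point, coordinates in which g is Euclidean map the
   boundary to a curve that is in general not straight.  Up to shrinking U,
   injective with invertible differential is the same as being a diffeomorphism
   onto its image. *)
Definition local_coordinates (U : set M) (x y : M -> R) : Prop :=
  [/\ open U,
      forall c, atlas S c -> smooth_in c U x /\ smooth_in c U y,
      forall p q, U p -> U q -> x p = x q -> y p = y q -> p = q
    & forall c p, atlas S c -> U p -> dom c p -> coframe c x y p \in unitmx].

Definition orthogonal_reflection (g : M -> 'M[R]_2) (T : M -> 'M[R]_2) : Prop :=
  [/\ forall c i j, atlas S c ->
        smooth_in c setT (fun p => endo_in c T p i j),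
      forall p, \det (T p) < 0 /\ (T p)^T *m g p *m T p = g p,
      forall p, T p *m T p = 1%:M
    & forall p, exists U x y, [/\ U p, local_coordinates U x y &
        forall c q, atlas S c -> U q -> dom c q ->
          let dx := differential c x q in
          let dy := differential c y q in
          let partial_x := col 0 (invmx (coframe c x y q)) in
          let partial_y := col 1 (invmx (coframe c x y q)) in
          bilin_in c g q = dx^T *m dx + dy^T *m dy /\
          endo_in c T q = partial_x *m dx - partial_y *m dy]].

(* xi |-> g (T xi, .) *)
Definition reflect_flat (g T : M -> 'M[R]_2) (xi : M -> 'cV[R]_2)
    : M -> 'rV[R]_2 :=
  fun p => (T p *m xi p)^T *m g p.

End Surface.

(* Main.v *)
Require Import Defs.
From mathcomp Require Import all_boot all_order all_algebra.
From mathcomp Require Import all_classical all_reals all_analysis.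
From mathcomp Require Import ring lra.
Import numFieldNormedType.Exports.
Import Order.TTheory GRing.Theory Num.Theory.
Local Open Scope classical_set_scope.
Local Open Scope ring_scope.

Set Implicit Arguments.
Unset Strict Implicit.
Unset Printing Implicit Defensive.

(* In local coordinates with g = dx^2 + dy^2 and R = diag(1, -1), write
   xi = u d/dx + v d/dy, so that xi^flat = u dx - v dy.  Then
   L_xi g = du dx + dx du + dv dy + dy dv is a multiple of g exactly when
   u_x = v_y and u_y + v_x = 0, and these Cauchy-Riemann equations are
   d(xi^flat) = -(u_y + v_x) dx /\ dy = 0 and
   d(star xi^flat) = +-(u_x - v_y) dx /\ dy = 0.
   The sign is that of the frame (dx, dy), which is locally constant.  In an
   arbitrary chart the only analytic inputs are the product rule and the
   symmetry of the second derivatives of x and y; at boundary points both are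
   read off from a local smooth extension beyond the half-plane. *)

(** The coordinates [x], [y] are not charts of the atlas, since they need not straighten the
    boundary. They enter only through the matrix C of dx and dy in a chart: g becomes C^T C, the
    reflection becomes C^-1 D C with D = diag(1, -1), and the conditions to be compared become
    equations between C and the matrix of du and dv. The functions u = dx(xi) and v = dy(xi) do not
    depend on the chart, so these equations can be moved from one chart to another.

    The resulting equivalence holds point by point, and two global matters remain. A preimage of a
    form alpha must be produced: as the reflection is an involution, it is the reflection applied to
    the metric dual of alpha. The conformal factor, obtained only at each point separately, must be
    a single smooth function: it equals half the trace of g^-1 L_xi g, which is smooth in each chart
    and agrees between charts because L_xi g is a tensor. *)

Lemma near_open_nbhs (T : topologicalType) (x : T) (P : set T) :
  (\forall z \near x, P z) -> exists2 W, open_nbhs x W & W `<=` P.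
Proof. by move=> xP; have : nbhs x P by []; rewrite nbhsE. Qed.

Lemma near_eq_differentiable (K : numFieldType) (V W : normedModType K)
    (f g : V -> W) (x : V) :
  (\near x, f x = g x) -> differentiable f x -> differentiable g x.
Proof.
move=> fg df.
suff dk : differentiable (g - f) x.
  by rewrite -[g](subrK f); exact: differentiableD.
have k0 : \forall y \near x, (g - f) y = 0.
  by apply: filterS fg => y /= fgy; rewrite !fctE fgy subrr.
apply/diffP => /=.
(* The differential is a chosen linear map, so it suffices to exhibit one with the defining
   expansion; near [x] the function [g - f] vanishes and the zero map does. *)
apply: (@getPex _ (fun (df : {linear V -> W}) => continuous df /\
  forall y, (g - f) y = (g - f) (lim (nbhs x)) + df (y - lim (nbhs x))
                  +o_(y \near x) (y - lim (nbhs x)))).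
pose df0 : {linear V -> W} := GRing.Linear.clone _ _ _ _ (\0 : V -> W) _.
exists df0; split; first exact: cst_continuous.
suff : (g - f) = (fun y => (g - f) (lim (nbhs x)) + df0 (y - lim (nbhs x)))
    +o_x (fun y => y - lim (nbhs x)) by rewrite funeqE.
apply/eqaddoP => eps eps0; rewrite lim_id//.
apply: filterS k0 => y k0y.
rewrite !fctE /= in k0y *.
by rewrite k0y (nbhs_singleton fg) subrr !addr0 subr0 normr0 mulr_ge0// ltW.
Qed.

(** * Calculus on the half-plane *)

Section Plane.
Context {R : realType}.
Implicit Types (f h : 'rV[R]_2 -> R) (q v : 'rV[R]_2) (V : set 'rV[R]_2).
Implicit Types (i j : 'I_2) (k : nat).

Local Notation H := (@half_plane R).
Local Notation e := (@basis_vec R).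

(** Both basis vectors have a nonnegative second coordinate, so small positive increments stay in
    the half-plane even from a boundary point. Hence the limit that defines [partial] is unique. *)
Lemma half_plane_within_proper i q : H q ->
  ProperFilter (within [set t : R | H (q + t *: e i)] 0^').
Proof.
move=> Hq; apply: Build_ProperFilter_ex => B.
rewrite /within /= => -[d /= d0 dB].
exists (d / 2); apply: dB => /=.
- by rewrite sub0r normrN gtr0_norm ?divr_gt0// gtr_pMr// invf_lt1// ltr1n.
- by rewrite gt_eqF// divr_gt0.
- move: Hq; rewrite /half_plane /= !mxE => Hq.
  by rewrite addr_ge0// mulr_ge0// ?ler0n// divr_ge0// ltW.
Qed.

(** The difference quotient of [h] still converges along the smaller filter of increments staying in
    the half-plane, and along that filter only values where [f] and [h] agree are seen. *)
Lemma partialE i q f h : H q -> differentiable h q ->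
  (\forall z \near q, H z -> f z = h z) -> partial i f q = 'D_(e i) h q.
Proof.
move=> Hq dh fh; rewrite /partial.
have PF := @half_plane_within_proper i q Hq.
apply: cvg_lim => //.
have D : (fun t => t^-1 *: ((h \o shift q) (t *: e i) - h q)) @ 0^' -->
    'D_(e i) h q by exact: diff_derivable.
have : (fun t => t^-1 *: ((h \o shift q) (t *: e i) - h q)) @
    within [set t : R | H (q + t *: e i)] 0^' --> 'D_(e i) h q.
  by apply: cvg_trans D; apply: cvg_app; exact: cvg_within.
apply: cvg_trans; apply: near_eq_cvg.
have fq : f q = h q by exact: (nbhs_singleton fh).
rewrite /within /=.
have cq : (fun t : R => q + t *: e i) t @[t --> 0] --> q.
  rewrite -[X in _ --> X](addr0 q) -(scale0r (e i)).
  by apply: cvgD; [exact: cvg_cst | apply: cvgZr_tmp; exact: cvg_id].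
have ft : \forall t \near (0 : R)^', H (q + t *: e i) ->
    f (q + t *: e i) = h (q + t *: e i) by exact/cvg_within/(cq _ fh).
suff : \forall t \near (0 : R)^', H (q + t *: e i) ->
    t^-1 *: (h (t *: e i + q) - h q) = t^-1 * (f (q + t *: e i) - f q) by [].
near=> t => Ht.
have -> : f (q + t *: e i) = h (q + t *: e i) by move: Ht; near: t.
by rewrite fq (addrC q).
Unshelve. all: by end_near.
Qed.

(** * Functions of class [Ck] on an open set of the plane *)

Lemma Ck_differentiable k V h q : Ck k.+1 V h -> V q -> differentiable h q.
Proof. by move=> [+ _]; exact. Qed.

Lemma Ck_derive k V h i : Ck k.+1 V h -> Ck k V ('D_(e i) h).
Proof. by move=> [_]; exact. Qed.

Lemma Ck_le1 k V h : Ck k.+1 V h -> Ck k V h.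
Proof.
elim: k h => [h [dh _] q Vq|k IH h [dh Dh]].
  exact/differentiable_continuous/dh.
by split=> // i; apply: IH; exact: Dh.
Qed.

(** The rules of differentiation give the derivative of a sum, product or inverse only at points of
    [V], not as an equality of functions; this lemma lets the inductions below use them. *)
Lemma Ck_eq k V f h : open V -> {in V, f =1 h} -> Ck k V f -> Ck k V h.
Proof.
move=> oV.
have nfh (f1 h1 : 'rV[R]_2 -> R) q : {in V, f1 =1 h1} -> V q ->
    \forall z \near q, f1 z = h1 z.
  move=> fh Vq; apply: filterS (open_nbhs_nbhs (conj oV Vq)) => z Vz.
  by rewrite fh// inE.
elim: k f h => [|k IH] f h fh.
  move=> cf q Vq; have nq := nfh _ _ _ fh Vq.
  rewrite /prop_for /continuous_at -(nbhs_singleton nq).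
  by apply: cvg_trans (cf q Vq); exact: (near_eq_cvg nq).
move=> [df Df]; split=> [q Vq|i].
  exact: near_eq_differentiable (nfh _ _ _ fh Vq) (df q Vq).
apply: IH (Df i) => q; rewrite inE => Vq.
exact: near_eq_derive (nfh _ _ _ fh Vq).
Qed.

Lemma Ck_cst k V (a : R) : Ck k V (cst a).
Proof.
elim: k a => [|k IH] a; first by move=> q _; exact: cst_continuous.
split=> [q _|i]; first exact: differentiable_cst.
by rewrite (_ : 'D_(e i) (cst a) = cst 0)//; apply/funext => q; rewrite derive_cst.
Qed.

Lemma CkD k V f h : open V -> Ck k V f -> Ck k V h ->
  Ck k V (fun q => f q + h q).
Proof.
move=> oV; elim: k f h => [|k IH] f h.
  by move=> cf ch q Vq; exact: (cvgD (cf q Vq) (ch q Vq)).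
move=> [df Df] [dh Dh]; split=> [q Vq|i].
  by apply: differentiableD; [exact: df | exact: dh].
apply: Ck_eq oV _ (IH _ _ (Df i) (Dh i)) => q; rewrite inE => Vq.
by rewrite -deriveD//; apply: diff_derivable; [exact: df | exact: dh].
Qed.

Lemma CkM k V f h : open V -> Ck k V f -> Ck k V h ->
  Ck k V (fun q => f q * h q).
Proof.
move=> oV; elim: k f h => [|k IH] f h.
  by move=> cf ch q Vq; exact: (cvgM (cf q Vq) (ch q Vq)).
move=> Cf Ch; split=> [q Vq|i].
  apply: differentiableM; [exact: Ck_differentiable Cf Vq|].
  exact: Ck_differentiable Ch Vq.
have C1 := CkD oV (IH _ _ (Ck_le1 Cf) (Ck_derive i Ch))
  (IH _ _ (Ck_le1 Ch) (Ck_derive i Cf)).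
apply: Ck_eq oV _ C1 => q; rewrite inE => Vq.
symmetry; apply: deriveM; apply: diff_derivable.
  exact: Ck_differentiable Cf Vq.
exact: Ck_differentiable Ch Vq.
Qed.

Lemma CkV k V f : open V -> (forall q, V q -> f q != 0) -> Ck k V f ->
  Ck k V (fun q => (f q)^-1).
Proof.
move=> oV f0; elim: k => [|k IH].
  by move=> cf q Vq; exact: (cvgV (f0 q Vq) (cf q Vq)).
move=> Cf; split=> [q Vq|i].
  by apply: differentiableV; [exact: Ck_differentiable Cf Vq | exact: f0].
have CV := IH (Ck_le1 Cf).
(* The derivative of the inverse is [- f^-2] times that of [f]; the first factor is of class [k] by
   the induction hypothesis used twice. *)
have C1 := CkM oV (CkM oV (@Ck_cst k V (-1)) (CkM oV CV CV)) (Ck_derive i Cf).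
apply: Ck_eq oV _ C1 => q; rewrite inE => Vq.
rewrite deriveV; [|exact: f0|].
  by rewrite /= mulN1r -exprVn expr2.
by apply: diff_derivable; exact: Ck_differentiable Cf Vq.
Qed.

Lemma Ck_sub k V (W : set 'rV[R]_2) f : W `<=` V -> Ck k V f -> Ck k W f.
Proof.
move=> WV; elim: k f => [|k IH] f; first by move=> cf q /WV; exact: cf.
by move=> [df Df]; split=> [q /WV|i]; [exact: df | exact/IH/Df].
Qed.

(** * Mean values along segments and the symmetry of second derivatives *)

Lemma derive_coord q v j : 'D_v (fun z : 'rV[R]_2 => z 0 j) q = v 0 j.
Proof.
have := derive_mx (@derivable_id _ _ q v); rewrite derive_id => {2}->.
by rewrite mxE.
Qed.

Lemma line_derive (V W : normedModType R) (f : V -> W) (p a : V) (s : R) :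
  differentiable f (p + s *: a) ->
  is_derive s (1 : R) (fun u : R => f (p + u *: a)) ('D_a f (p + s *: a)).
Proof.
move=> df.
have E : (fun h : R => h^-1 *: (((fun u : R => f (p + u *: a)) \o shift s)
      (h *: (1 : R)) - f (p + s *: a))) =
    (fun h : R => h^-1 *: ((f \o shift (p + s *: a)) (h *: a) - f (p + s *: a))).
  apply/funext => h /=; congr (_ *: (f _ - _)).
  by rewrite [h *: 1]mulr1 scalerDl addrCA.
apply: DeriveDef.
  by rewrite /derivable E; exact: diff_derivable.
by rewrite {1}/derive E.
Qed.

Lemma line_mean_value (f : 'rV[R]_2 -> R) (p a : 'rV[R]_2) (s : R) : 0 < s ->
  (forall u, 0 <= u <= s -> differentiable f (p + u *: a)) ->
  exists2 u, 0 <= u <= s & f (p + s *: a) - f p = s * 'D_a f (p + u *: a).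
Proof.
move=> s0 df.
have D u : u \in `]0, s[ ->
    is_derive u (1 : R) (fun u : R => f (p + u *: a)) ('D_a f (p + u *: a)).
  rewrite in_itv/= => /andP[u0 us]; apply: line_derive; apply: df.
  by rewrite !ltW.
have C : {within `[0, s], continuous (fun u : R => f (p + u *: a))}.
  apply: derivable_within_continuous => u; rewrite in_itv/= => u0s.
  by have [] := line_derive (df u u0s).
have [u] := MVT s0 D C.
rewrite in_itv/= scale0r addr0 subr0 => /andP[u0 us] ->.
by exists u; [rewrite !ltW | rewrite mulrC].
Qed.

(** The mean value theorem is applied twice: along [a] to the increment of [f] in direction
    [s *: b], then along [b] to the derivative of [f] in direction [a]. *)
Lemma second_difference f (q a b : 'rV[R]_2) (s : R) :
  0 < s ->
  (forall u w, 0 <= u <= s -> 0 <= w <= s ->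
     differentiable f (q + u *: a + w *: b) /\
     differentiable ('D_a f) (q + u *: a + w *: b)) ->
  exists u w, [/\ 0 <= u <= s, 0 <= w <= s &
    f (q + s *: a + s *: b) - f (q + s *: a) - (f (q + s *: b) - f q)
    = s * (s * 'D_b ('D_a f) (q + u *: a + w *: b))].
Proof.
move=> s0 df.
have ss : 0 <= s <= s by rewrite lexx ltW.
have s00 : (0 : R) <= 0 <= s by rewrite lexx ltW.
have dfa u : 0 <= u <= s -> differentiable f (q + u *: a).
  by move=> us; have [+ _] := df u 0 us s00; rewrite scale0r addr0.
have dfb u : 0 <= u <= s -> differentiable (fun z => f (z + s *: b)) (q + u *: a).
  move=> us; apply: (@differentiable_comp _ _ _ _ (fun z => z + s *: b) f).
    have : differentiable (id + cst (s *: b)) (q + u *: a).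
      exact: (differentiableD ex_diff (differentiable_cst _ _)).
    by [].
  exact: (df u s us ss).1.
have Db u : 0 <= u <= s ->
    'D_a (fun z => f (z + s *: b)) (q + u *: a) = 'D_a f (q + u *: a + s *: b).
  move=> us; rewrite /derive.
  suff -> : (fun z => f (z + s *: b)) \o shift (q + u *: a) =
      f \o shift (q + u *: a + s *: b) by [].
  by apply/funext => h /=; rewrite !addrA.
have [u us E] : exists2 u, 0 <= u <= s &
    (fun z => f (z + s *: b) - f z) (q + s *: a)
    - (fun z => f (z + s *: b) - f z) q
    = s * 'D_a (fun z => f (z + s *: b) - f z) (q + u *: a).
  apply: line_mean_value s0 _ => u us.
  by apply: differentiableB; [exact: dfb | exact: dfa].
have [w ws E'] := line_mean_value s0 (fun w ws => (df u w us ws).2).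
exists u, w; split=> //; rewrite E; congr (_ * _); rewrite -E' -Db//.
by apply: deriveB; apply: diff_derivable; [exact: dfb | exact: dfa].
Qed.

(** The second difference of [f] over a small square is symmetric in the two directions, and divided
    by [s^2] it is a value of either mixed derivative somewhere in the square. By continuity the two
    mixed derivatives at [q] differ by less than any [eps]. *)
Lemma derive_comm V f q (i j : 'I_2) : open V -> V q -> Ck 2 V f ->
  'D_(e i) ('D_(e j) f) q = 'D_(e j) ('D_(e i) f) q.
Proof.
move=> oV Vq Cf.
apply/eqP; rewrite -subr_eq0 -normr_le0; apply/ler_addgt0Pl => eps eps0.
rewrite addr0.
have C0 (k l : 'I_2) : \forall z \near q,
    `|'D_(e k) ('D_(e l) f) q - 'D_(e k) ('D_(e l) f) z| < eps / 2.
  have := Ck_derive k (Ck_derive l Cf) _ Vq.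
  by move=> /cvgrPdist_lt; apply; rewrite divr_gt0.
have [d /= d0 dB] := (nbhs_ballP _ _).1
  (filterI (filterI (C0 i j) (C0 j i)) (open_nbhs_nbhs (conj oV Vq))).
(* This side length keeps the whole square inside the ball of radius [d]; the added 1 makes the
   denominator positive and the bound strict. *)
pose s := d / (`|e i| + `|e j| + 1).
have N0 : 0 < `|e i| + `|e j| + 1 by rewrite ltr_wpDl ?addr_ge0.
have s0 : 0 < s by rewrite divr_gt0.
have sB u w (k l : 'I_2) : `|e k| + `|e l| = `|e i| + `|e j| ->
    0 <= u <= s -> 0 <= w <= s -> ball q d (q + u *: e k + w *: e l).
  move=> kl /andP[u0 us] /andP[w0 ws].
  rewrite -ball_normE /= -addrA opprD addNKr normrN.
  apply: le_lt_trans (ler_normD _ _) _; rewrite !normrZ !ger0_norm//.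
  apply: (@le_lt_trans _ _ (s * (`|e i| + `|e j|))).
    by rewrite -kl mulrDr lerD// ler_wpM2r.
  by rewrite mulrAC ltr_pdivrMr// ltr_pM2l// ltrDl.
have sD (k l : 'I_2) : `|e k| + `|e l| = `|e i| + `|e j| ->
  forall u w, 0 <= u <= s -> 0 <= w <= s ->
     differentiable f (q + u *: e k + w *: e l) /\
     differentiable ('D_(e k) f) (q + u *: e k + w *: e l).
  move=> kl u w us ws; have [_ Vz] := dB _ (sB _ _ _ _ kl us ws).
  split; first exact: Ck_differentiable Cf Vz.
  exact: Ck_differentiable (Ck_derive k Cf) Vz.
have [u [w [us ws E]]] := @second_difference f q (e i) (e j) s s0 (sD i j erefl).
have [u' [w' [us' ws' E']]] :=
  @second_difference f q (e j) (e i) s s0 (sD j i (addrC _ _)).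
have [[_ B1] _] := dB _ (sB _ _ _ _ erefl us ws).
have [[B2 _] _] := dB _ (sB _ _ _ _ (addrC _ _) us' ws').
(* The far corner is reached in either order, so both second differences involve the same four
   values of [f]. *)
rewrite (addrAC q (s *: e j)) in E'.
have cancel (x y a b c g : R) : a - b - (c - g) = s * (s * x) ->
    a - c - (b - g) = s * (s * y) -> x = y.
  move=> Ex Ey; have ns : s != 0 by rewrite gt_eqF.
  apply: (mulfI ns); apply: (mulfI ns); rewrite -Ex -Ey.
  by rewrite !opprB addrACA [RHS]addrACA [in RHS](addrC (- _)).
have EE := cancel _ _ _ _ _ _ E E'.
rewrite EE in B1.
apply: ltW; rewrite (splitr eps).
rewrite -(subrKA ('D_(e i) ('D_(e j) f) (q + u' *: e j + w' *: e i))).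
apply: le_lt_trans (ler_normD _ _) _.
by apply: ltrD; [exact: B2 | rewrite distrC; exact: B1].
Qed.

(** * Smoothness and partial derivatives at a point of the half-plane *)

Definition smooth_near (q : 'rV[R]_2) f := exists V h,
  [/\ open V, V q, forall k, Ck k V h & forall z, H z -> V z -> f z = h z].

Lemma partial_extension V f h i q : open V -> (forall k, Ck k V h) ->
  (forall z, H z -> V z -> f z = h z) -> H q -> V q ->
  partial i f q = 'D_(e i) h q.
Proof.
move=> oV Ch fh Hq Vq; apply: partialE => //.
  exact: Ck_differentiable (Ch 1%N) Vq.
by apply: filterS (open_nbhs_nbhs (conj oV Vq)) => z Vz Hz; exact: fh.
Qed.

(** Agreement is asked only inside the half-plane, since values outside it carry no meaning for
    functions read in a chart. *)
Lemma smooth_near_eq q f g : (\forall z \near q, H z -> f z = g z) ->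
  smooth_near q f -> smooth_near q g.
Proof.
move=> /near_open_nbhs[W [oW Wq] WE] [V [h [oV Vq Ch fh]]].
exists (V `&` W), h; split=> //; first exact: openI.
  by move=> k; apply: Ck_sub (Ch k) => z [].
by move=> z Hz [Vz Wz]; rewrite -(WE z Wz Hz) fh.
Qed.

Lemma smooth_near_partial i q f : smooth_near q f -> smooth_near q (partial i f).
Proof.
move=> [V [h [oV Vq Ch fh]]]; exists V, ('D_(e i) h); split=> //.
  by move=> k; exact: Ck_derive (Ch k.+1).
by move=> z Hz Vz; exact: partial_extension Ch fh Hz Vz.
Qed.

Lemma smooth_near_cst q (a : R) : smooth_near q (cst a).
Proof. by exists setT, (cst a); split=> // [|k]; [exact: openT | exact: Ck_cst]. Qed.

Lemma smooth_near_common_extension q f g : smooth_near q f -> smooth_near q g ->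
  exists V f1 g1, [/\ open V, V q, forall k, Ck k V f1, forall k, Ck k V g1 &
    forall z, H z -> V z -> f z = f1 z /\ g z = g1 z].
Proof.
move=> [V [f1 [oV Vq Cf ff]]] [W [g1 [oW Wq Cg gg]]].
exists (V `&` W), f1, g1; split=> //.
- exact: openI.
- by move=> k; apply: Ck_sub (Cf k) => z [].
- by move=> k; apply: Ck_sub (Cg k) => z [].
- by move=> z Hz [Vz Wz]; rewrite ff// gg.
Qed.

Lemma smooth_nearD q f g : smooth_near q f -> smooth_near q g ->
  smooth_near q (fun z => f z + g z).
Proof.
move=> sf sg; have [V [f1 [g1 [oV Vq Cf Cg fg]]]] := smooth_near_common_extension sf sg.
exists V, (fun z => f1 z + g1 z); split=> // [k|z Hz Vz]; first exact: CkD.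
by have [-> ->] := fg z Hz Vz.
Qed.

Lemma smooth_nearM q f g : smooth_near q f -> smooth_near q g ->
  smooth_near q (fun z => f z * g z).
Proof.
move=> sf sg; have [V [f1 [g1 [oV Vq Cf Cg fg]]]] := smooth_near_common_extension sf sg.
exists V, (fun z => f1 z * g1 z); split=> // [k|z Hz Vz]; first exact: CkM.
by have [-> ->] := fg z Hz Vz.
Qed.

Lemma smooth_near_cvg q f : H q -> smooth_near q f ->
  exists2 h : 'rV[R]_2 -> R, h z @[z --> q] --> f q &
    \forall z \near q, H z -> f z = h z.
Proof.
move=> Hq [V [h [oV Vq Ch fh]]]; exists h; first by rewrite fh//; exact: Ch 0%N _ Vq.
by apply: filterS (open_nbhs_nbhs (conj oV Vq)) => z Vz Hz; exact: fh.
Qed.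

Lemma smooth_nearV q f : H q -> f q != 0 -> smooth_near q f ->
  smooth_near q (fun z => (f z)^-1).
Proof.
move=> Hq f0 [V [h [oV Vq Ch fh]]].
(* Nonvanishing of [f] says nothing about its extension [h] beyond the half-plane, so the
   neighbourhood is shrunk to one where [h] has no zero. *)
have /near_open_nbhs[W [oW Wq] WE] : \forall z \near q, h z != 0.
  apply: (@cvgr_neq0 _ _ _ (nbhs q) _ h (h q)); last by rewrite -fh.
  exact: (Ch 0%N).
exists (V `&` W), (fun z => (h z)^-1); split=> //; first exact: openI.
  move=> k; apply: CkV; first exact: openI.
    by move=> z [_ /WE].
  by apply: Ck_sub (Ch k) => z [].
by move=> z Hz [Vz Wz]; rewrite fh.
Qed.

Lemma partial_near_eq q f g i : H q -> (\forall z \near q, H z -> f z = g z) ->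
  smooth_near q f -> partial i f q = partial i g q.
Proof.
move=> Hq fg [V [h [oV Vq Ch fh]]].
rewrite (partial_extension i oV Ch fh Hq Vq).
symmetry; apply: partialE => //; first exact: Ck_differentiable (Ch 1%N) Vq.
have [W oW WE] := near_open_nbhs fg.
apply: filterS (open_nbhs_nbhs (open_nbhsI (conj oV Vq) oW)) => z [Vz Wz] Hz.
by rewrite -(WE z Wz Hz) fh.
Qed.

Lemma partialD q f g i : H q -> smooth_near q f -> smooth_near q g ->
  partial i (fun z => f z + g z) q = partial i f q + partial i g q.
Proof.
move=> Hq sf sg; have [V [f1 [g1 [oV Vq Cf Cg fg]]]] := smooth_near_common_extension sf sg.
have fg1 z (Hz : H z) (Vz : V z) := (fg z Hz Vz).1.
have fg2 z (Hz : H z) (Vz : V z) := (fg z Hz Vz).2.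
have CS k : Ck k V (fun z => f1 z + g1 z) by exact: CkD.
rewrite (partial_extension i oV Cf fg1)// (partial_extension i oV Cg fg2)//.
rewrite (partial_extension i oV CS)//; last by move=> z Hz Vz; rewrite fg1// fg2.
by apply: deriveD; apply: diff_derivable;
  [exact: Ck_differentiable (Cf 1%N) Vq | exact: Ck_differentiable (Cg 1%N) Vq].
Qed.

Lemma partialM q f g i : H q -> smooth_near q f -> smooth_near q g ->
  partial i (fun z => f z * g z) q = f q * partial i g q + g q * partial i f q.
Proof.
move=> Hq sf sg; have [V [f1 [g1 [oV Vq Cf Cg fg]]]] := smooth_near_common_extension sf sg.
have fg1 z (Hz : H z) (Vz : V z) := (fg z Hz Vz).1.
have fg2 z (Hz : H z) (Vz : V z) := (fg z Hz Vz).2.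
have CS k : Ck k V (fun z => f1 z * g1 z) by exact: CkM.
rewrite (partial_extension i oV Cf fg1)// (partial_extension i oV Cg fg2)//.
rewrite (partial_extension i oV CS)//; last by move=> z Hz Vz; rewrite fg1// fg2.
rewrite fg1// fg2//.
by apply: deriveM; apply: diff_derivable;
  [exact: Ck_differentiable (Cf 1%N) Vq | exact: Ck_differentiable (Cg 1%N) Vq].
Qed.

Lemma partial_cst q (a : R) i : H q -> partial i (cst a) q = 0.
Proof.
move=> Hq; rewrite (partialE i (h := cst a))//; first exact: derive_cst.
exact: filterS filterT.
Qed.

Lemma partial_comm q f i j : H q -> smooth_near q f ->
  partial i (partial j f) q = partial j (partial i f) q.
Proof.
move=> Hq [V [h [oV Vq Ch fh]]].
have D (k : 'I_2) := fun z Hz Vz => @partial_extension V f h k z oV Ch fh Hz Vz.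
have CD (k : 'I_2) l : Ck l V ('D_(e k) h) by exact: Ck_derive (Ch l.+1).
have Eij := partial_extension i oV (CD j) (D j) Hq Vq.
have Eji := partial_extension j oV (CD i) (D i) Hq Vq.
have Dij := derive_comm i j oV Vq (Ch 2%N).
etransitivity; first exact: Eij.
etransitivity; first exact: Dij.
exact: esym Eji.
Qed.

Lemma row_comb (v : 'rV[R]_2) : v = v 0 0 *: e 0 + v 0 1 *: e 1.
Proof.
rewrite [LHS]row_sum_delta big_ord_recl big_ord1.
by congr (_ + v _ _ *: e _); exact/val_inj.
Qed.

(** The extension [psi] of [phi] may leave the half-plane, where [f] itself is meaningless. The
    composite of the two extensions is differentiable there and agrees with [f \o phi] on the
    half-plane, so the ordinary chain rule applies to it. *)
Lemma partial_comp q f (phi : 'rV[R]_2 -> 'rV[R]_2) j : H q -> H (phi q) ->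
  (forall i, smooth_near q (fun z => phi z 0 i)) ->
  (\forall z \near q, H z -> H (phi z)) ->
  smooth_near (phi q) f ->
  partial j (f \o phi) q = partial 0 f (phi q) * partial j (fun z => phi z 0 0) q
                         + partial 1 f (phi q) * partial j (fun z => phi z 0 1) q.
Proof.
move=> Hq Hphi sphi nphi [V [h [oV Vq Ch fh]]].
have [W [p0 [p1 [oW Wq C0 C1 pE]]]] := smooth_near_common_extension (sphi 0) (sphi 1).
have pE0 z (Hz : H z) (Vz : W z) := (pE z Hz Vz).1.
have pE1 z (Hz : H z) (Vz : W z) := (pE z Hz Vz).2.
rewrite (partial_extension j oW C0 pE0)// (partial_extension j oW C1 pE1)//.
rewrite !(partial_extension _ oV Ch fh)//.
have d0 := Ck_differentiable (C0 1%N) Wq.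
have d1 := Ck_differentiable (C1 1%N) Wq.
pose psi z := p0 z *: e 0 + p1 z *: e 1.
have dpsi : differentiable psi q.
  by apply: differentiableD; exact: differentiableZl.
have psiE z : H z -> W z -> psi z = phi z.
  by move=> Hz Wz; rewrite (row_comb (phi z)) /psi pE0// pE1.
have dh : differentiable h (psi q).
  by rewrite psiE//; exact: Ck_differentiable (Ch 1%N) Vq.
have cpsi := differentiable_continuous dpsi.
rewrite (partialE j (h := h \o psi))//; first last.
- have nV : \forall z \near q, V (psi z).
    by apply: cpsi; rewrite psiE//; exact: open_nbhs_nbhs.
  have [X oX XE] := near_open_nbhs nphi; have [Y oY YE] := near_open_nbhs nV.
  have oXYW := open_nbhsI (open_nbhsI oX oY) (conj oW Wq).
  apply: filterS (open_nbhs_nbhs oXYW) => z [[Xz Yz] Wz] Hz /=.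
  have := YE z Yz; rewrite psiE// => Vz; apply: fh => //; exact: XE.
- exact: differentiable_comp.
rewrite deriveE; last exact: differentiable_comp.
rewrite diff_comp//=.
have D (k : 'I_2) : ('d psi q (e j) : 'rV[R]_2) 0 k = 'D_(e j) (fun z => psi z 0 k) q.
  by rewrite -deriveE// derive_mx ?mxE//; exact: diff_derivable.
have psi0 : (fun z => psi z 0 0) = p0.
  by apply/funext => z; rewrite /psi !mxE /= mulr1 mulr0 addr0.
have psi1 : (fun z => psi z 0 1) = p1.
  by apply/funext => z; rewrite /psi !mxE /= mulr1 mulr0 add0r.
rewrite [X in 'd h _ X]row_comb !D psi0 psi1.
rewrite psiE// in dh *.
rewrite (deriveE (e 0) dh) (deriveE (e 1) dh) linearD !linearZ.
by congr (_ + _); exact: mulrC.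
Qed.

End Plane.

(** * Functions in charts *)

Section Charts.
Context {R : realType} {M : topologicalType}.
Implicit Types (a c : chart R M) (f g : M -> R) (p q : M) (U : set M).
Implicit Types (i j : 'I_2).

Local Notation H := (@half_plane R).
Local Notation coord := Defs.coord.

Definition smooth_at c p f := smooth_near (coord c p) (f \o pt c).

Lemma coord_half_plane c p : dom c p -> H (coord c p).
Proof.
move=> cp; have [V _ VE] := coord_dom c.
have : (coord c @` dom c) (coord c p) by exists p.
by rewrite VE => -[].
Qed.

(** The image of a chart is relatively open in the half-plane and [pt] is continuous on it. This
    turns neighbourhoods in the surface into neighbourhoods in the plane. *)
Lemma chart_near c p (P : set M) : dom c p -> (\forall q \near p, P q) ->
  \forall z \near coord c p, H z ->
    [/\ dom c (pt c z), P (pt c z) & coord c (pt c z) = z].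
Proof.
move=> cp nP; have [V oV VE] := coord_dom c.
have VHp : (V `&` H) (coord c p) by rewrite -VE; exists p.
have cpt : \forall z \near coord c p, (coord c @` dom c) z -> P (pt c z).
  have /subspace_continuousP ptc := @pt_continuous _ _ c.
  have Ap : (coord c @` dom c) (coord c p) by exists p.
  have nPc : nbhs (pt c (coord c p)) P by rewrite coordK.
  exact: (ptc _ Ap _ nPc).
have [W oW WE] := near_open_nbhs cpt.
apply: filterS (open_nbhs_nbhs (open_nbhsI oW (conj oV VHp.1))) => z [Wz Vz] Hz.
have Az : (coord c @` dom c) z by rewrite VE.
have [q cq qz] := Az; split; last by rewrite -qz coordK.
- by rewrite -qz coordK.
- exact: WE.
Qed.

Lemma smooth_in_at c U f p : open U -> smooth_in c U f -> U p -> dom c p ->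
  smooth_at c p f.
Proof.
move=> oU sf Up cp.
have [V [h [oV Vp Ch fh]]] : exists V h, [/\ open V, V (coord c p),
    forall k, Ck k V h & forall z, (coord c @` (U `&` dom c)) z -> V z ->
      (f \o pt c) z = h z].
  by apply: sf; exists p.
have [W [oW Wp] WE] := near_open_nbhs (chart_near cp (open_nbhs_nbhs (conj oU Up))).
exists (V `&` W), h; split=> //; first exact: openI.
  by move=> k; apply: Ck_sub (Ch k) => z [].
move=> z Hz [Vz Wz]; apply: fh => //.
by have [cz Uz zE] := WE z Wz Hz; exists (pt c z).
Qed.

Lemma smooth_at_in c f : (forall p, dom c p -> smooth_at c p f) ->
  smooth_in c setT f.
Proof.
move=> sf _ [p [_ cp] <-]; have [V [h [oV Vp Ch fh]]] := sf p cp.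
exists V, h; split=> // _ [q [_ cq] <-]; apply: fh; exact: coord_half_plane.
Qed.

Lemma near_comp_pt c p f g : dom c p -> (\forall q \near p, f q = g q) ->
  \forall z \near coord c p, H z -> (f \o pt c) z = (g \o pt c) z.
Proof.
move=> cp fg; have [W oW WE] := near_open_nbhs (chart_near cp fg).
by apply: filterS (open_nbhs_nbhs oW) => z Wz Hz; have [] := WE z Wz Hz.
Qed.

Lemma smooth_at_eq c p f g : dom c p -> (\forall q \near p, f q = g q) ->
  smooth_at c p f -> smooth_at c p g.
Proof. by move=> cp fg; exact/smooth_near_eq/near_comp_pt. Qed.

Lemma pd_eq c i p f g : dom c p -> (\forall q \near p, f q = g q) ->
  smooth_at c p f -> pd c i f p = pd c i g p.
Proof.
move=> cp fg; apply: partial_near_eq; first exact: coord_half_plane.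
exact: near_comp_pt.
Qed.

Lemma smooth_at_cst c p (k : R) : smooth_at c p (cst k).
Proof. exact: smooth_near_cst. Qed.

Lemma smooth_atD c p f g : smooth_at c p f -> smooth_at c p g ->
  smooth_at c p (fun q => f q + g q).
Proof. exact: smooth_nearD. Qed.

Lemma smooth_atM c p f g : smooth_at c p f -> smooth_at c p g ->
  smooth_at c p (fun q => f q * g q).
Proof. exact: smooth_nearM. Qed.

Lemma smooth_atV c p f : dom c p -> f p != 0 -> smooth_at c p f ->
  smooth_at c p (fun q => (f q)^-1).
Proof.
move=> cp fp; apply: smooth_nearV; first exact: coord_half_plane.
by rewrite /= coordK.
Qed.

Lemma pdD c i p f g : dom c p -> smooth_at c p f -> smooth_at c p g ->
  pd c i (fun q => f q + g q) p = pd c i f p + pd c i g p.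
Proof. by move=> cp; apply: partialD; exact: coord_half_plane. Qed.

Lemma pdM c i p f g : dom c p -> smooth_at c p f -> smooth_at c p g ->
  pd c i (fun q => f q * g q) p = f p * pd c i g p + g p * pd c i f p.
Proof.
move=> cp sf sg; rewrite [LHS]partialM//; last exact: coord_half_plane.
by rewrite /= coordK.
Qed.

Lemma pd_cst c i p (k : R) : dom c p -> pd c i (cst k) p = 0.
Proof. by move=> cp; apply: partial_cst; exact: coord_half_plane. Qed.

(** [pd] evaluates at [coord c (pt c z)], which is [z] only on the image of the chart; hence the
    restriction to nearby points, which iterated derivatives must carry along. *)
Lemma pd_comp_pt c i p f : dom c p -> \forall z \near coord c p, H z ->
  partial i (f \o pt c) z = (pd c i f \o pt c) z.
Proof.
move=> cp; have [W oW WE] := near_open_nbhs (chart_near cp (filterT : nbhs p setT)).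
apply: filterS (open_nbhs_nbhs oW) => z Wz Hz.
by have [_ _ zE] := WE z Wz Hz; rewrite /= /pd zE.
Qed.

Lemma smooth_at_pd c i p f : dom c p -> smooth_at c p f ->
  smooth_at c p (pd c i f).
Proof.
move=> cp sf; apply: smooth_near_eq (pd_comp_pt i f cp) _.
exact: smooth_near_partial.
Qed.

Lemma pd_comm c i j p f : dom c p -> smooth_at c p f ->
  pd c i (pd c j f) p = pd c j (pd c i f) p.
Proof.
move=> cp sf; have Hp := coord_half_plane cp.
have E k l : pd c k (pd c l f) p = partial k (partial l (f \o pt c)) (coord c p).
  symmetry; apply: partial_near_eq => //; first exact: pd_comp_pt.
  exact: smooth_near_partial.
by rewrite !E; exact: partial_comm.
Qed.

(** * Smooth matrix-valued functions and the chain rule between charts *)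

Lemma smooth_at_sum (I : Type) (r : seq I) (F : I -> M -> R) c p :
  (forall k, smooth_at c p (F k)) ->
  smooth_at c p (fun q => \sum_(k <- r) F k q).
Proof.
move=> sF; elim: r => [|k r IH].
  by under eq_fun do rewrite big_nil; exact: smooth_at_cst.
by under eq_fun do rewrite big_cons; exact: smooth_atD.
Qed.

Lemma smooth_at_prod (I : Type) (r : seq I) (F : I -> M -> R) c p :
  (forall k, smooth_at c p (F k)) ->
  smooth_at c p (fun q => \prod_(k <- r) F k q).
Proof.
move=> sF; elim: r => [|k r IH].
  by under eq_fun do rewrite big_nil; exact: smooth_at_cst.
by under eq_fun do rewrite big_cons; exact: smooth_atM.
Qed.

Definition smooth_mx_at c p m n (A : M -> 'M[R]_(m, n)) :=
  forall k l, smooth_at c p (fun q => A q k l).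

Lemma smooth_at_mulmx c p m n r (A : M -> 'M[R]_(m, n)) (B : M -> 'M[R]_(n, r)) :
  smooth_mx_at c p A -> smooth_mx_at c p B ->
  smooth_mx_at c p (fun q => A q *m B q).
Proof.
move=> sA sB k l; under eq_fun do rewrite mxE.
by apply: smooth_at_sum => s; exact: smooth_atM.
Qed.

Lemma smooth_at_trmx c p m n (A : M -> 'M[R]_(m, n)) :
  smooth_mx_at c p A -> smooth_mx_at c p (fun q => (A q)^T).
Proof. by move=> sA k l; under eq_fun do rewrite mxE. Qed.

Lemma smooth_at_det c p n (A : M -> 'M[R]_n) : smooth_mx_at c p A ->
  smooth_at c p (fun q => \det (A q)).
Proof.
move=> sA; rewrite /determinant; apply: smooth_at_sum => s.
apply: smooth_atM; first exact: smooth_at_cst.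
exact: smooth_at_prod.
Qed.

Lemma smooth_at_invmx c p n (A : M -> 'M[R]_n) : dom c p ->
  smooth_mx_at c p A -> (\forall q \near p, A q \in unitmx) ->
  smooth_mx_at c p (fun q => invmx (A q)).
Proof.
move=> cp sA uA k l.
apply: (@smooth_at_eq c p (fun q => (\det (A q))^-1 * \adj (A q) k l)) => //.
  by apply: filterS uA => q Aq; rewrite /invmx Aq [RHS]mxE.
apply: smooth_atM.
  apply: smooth_atV => //; last exact: smooth_at_det.
  by have := nbhs_singleton uA; rewrite unitmxE unitfE.
under eq_fun do rewrite mxE /cofactor.
apply: smooth_atM; first exact: smooth_at_cst.
apply: smooth_at_det => s t; under eq_fun do rewrite !mxE; exact: sA.
Qed.

Lemma sum2 (F : 'I_2 -> R) : \sum_i F i = F 0 + F 1.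
Proof. by rewrite big_ord_recl big_ord1; congr (_ + F _); exact/val_inj. Qed.

(** This is [partial_comp] for the transition map [phi], through which [f \o pt a] factors as
    [f \o pt c \o phi] near the point. *)
Lemma pd_chain a c p f j : dom a p -> dom c p ->
  (forall i, smooth_at a p (fun q => coord c q 0 i)) ->
  smooth_at a p f -> smooth_at c p f ->
  pd a j f p = \sum_i pd c i f p * Jac a c p i j.
Proof.
move=> ap cp sc sfa sfc; rewrite sum2 !mxE.
have Ha := coord_half_plane ap; have Hc := coord_half_plane cp.
have nc := chart_near ap (open_nbhs_nbhs (conj (@dom_open _ _ c) cp)).
have [W oW WE] := near_open_nbhs nc.
pose phi z := coord c (pt a z).
have phia : phi (coord a p) = coord c p by rewrite /phi coordK.
rewrite /pd -phia -[RHS](@partial_comp _ (coord a p) (f \o pt c) phi j)//.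
- apply: partial_near_eq => //.
  apply: filterS (open_nbhs_nbhs oW) => z Wz Hz /=.
  by have [_ cz _] := WE z Wz Hz; rewrite /phi coordK.
- by rewrite phia.
- apply: filterS (open_nbhs_nbhs oW) => z Wz Hz.
  by have [_ cz _] := WE z Wz Hz; exact: coord_half_plane.
- by rewrite phia.
Qed.

Lemma Jac_id c p : dom c p -> Jac c c p = 1%:M.
Proof.
move=> cp; apply/matrixP => i j; rewrite !mxE.
have [W oW WE] := near_open_nbhs (chart_near cp (filterT : nbhs p setT)).
rewrite /pd (partialE j (h := fun z : 'rV[R]_2 => z 0 i)) ?derive_coord ?mxE//.
- exact: coord_half_plane.
- exact: differentiable_coord.
- apply: filterS (open_nbhs_nbhs oW) => z Wz Hz /=.
  by have [_ _ ->] := WE z Wz Hz.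
Qed.

End Charts.

Lemma ord2_ind (P : 'I_2 -> Prop) : P 0 -> P 1 -> forall i, P i.
Proof.
move=> P0 P1 [[|[|i]] lti]//.
  by rewrite (_ : Ordinal lti = 0)//; exact/val_inj.
by rewrite (_ : Ordinal lti = 1)//; exact/val_inj.
Qed.

(** * Pointwise linear algebra *)

Section Algebra.
Context {R : realType}.
Implicit Types A C : 'M[R]_2.

Lemma det2 A : \det A = A 0 0 * A 1 1 - A 0 1 * A 1 0.
Proof.
rewrite (expand_det_row _ 0) sum2 /cofactor !det_mx11 !mxE /= expr0 mul1r expr1.
rewrite mulN1r mulrN; congr (_ * A _ _ - _ * A _ _); exact/val_inj.
Qed.

(* The rows of C are dx, dy and those of A are du, dv: the left-hand side says
   that du dx + dx du + dv dy + dy dv = F (dx^2 + dy^2), the right-hand side that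
   du /\ dx = dv /\ dy and du /\ dy + dv /\ dx = 0.  Both are read off from the
   Jacobian matrix B = A C^-1 of (u, v) with respect to (x, y). *)
Lemma conformal_iff_wedge A C : C \in unitmx ->
  (exists F, A^T *m C + C^T *m A = F *: (C^T *m C)) <->
  (A 0 0 * C 0 1 - A 0 1 * C 0 0 - (A 1 0 * C 1 1 - A 1 1 * C 1 0) = 0 /\
   A 0 0 * C 1 1 - A 0 1 * C 1 0 + (A 1 0 * C 0 1 - A 1 1 * C 0 0) = 0).
Proof.
move=> uC; have [B ->] : exists B, A = B *m C.
  by exists (A *m invmx C); rewrite mulmxKV.
have -> : (B *m C)^T *m C + C^T *m (B *m C) = C^T *m (B^T + B) *m C.
  by rewrite trmx_mul mulmxDr mulmxDl !mulmxA.
have d0 : C 0 0 * C 1 1 - C 0 1 * C 1 0 != 0 by rewrite -det2 -unitfE -unitmxE.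
have W1 : (B *m C) 0 0 * C 0 1 - (B *m C) 0 1 * C 0 0
    - ((B *m C) 1 0 * C 1 1 - (B *m C) 1 1 * C 1 0)
    = - (B 0 1 + B 1 0) * (C 0 0 * C 1 1 - C 0 1 * C 1 0).
  by rewrite !mxE !sum2; ring.
have W2 : (B *m C) 0 0 * C 1 1 - (B *m C) 0 1 * C 1 0
    + ((B *m C) 1 0 * C 0 1 - (B *m C) 1 1 * C 0 0)
    = (B 0 0 - B 1 1) * (C 0 0 * C 1 1 - C 0 1 * C 1 0).
  by rewrite !mxE !sum2; ring.
rewrite W1 W2; split=> [[F E]|[/eqP + /eqP]].
  have {E} E : B^T + B = F%:M.
    have uCt : C^T \in unitmx by rewrite unitmx_tr.
    apply: (can_inj (mulKmx uCt)).
    apply: (can_inj (mulmxK uC)).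
    by rewrite E mul_mx_scalar scalemxAl.
  have E' i j := congr1 (fun Z : 'M[R]_2 => Z i j) E.
  have := E' 0 0; have := E' 1 1; have := E' 0 1; rewrite !mxE /= => E01 E11 E00.
  by split; apply/eqP; rewrite mulf_eq0 (negPf d0) orbF; apply/eqP; lra.
rewrite !mulf_eq0 (negPf d0) !orbF => /eqP E1 /eqP E2.
exists (B 0 0 + B 0 0); rewrite (_ : B^T + B = (B 0 0 + B 0 0)%:M).
  by rewrite mul_mx_scalar scalemxAl.
apply/matrixP; elim/ord2_ind; elim/ord2_ind; rewrite !mxE /=; lra.
Qed.

(** The rows of [E] form an orthonormal coframe for [E^T *m E], in which the star is a quarter turn
    of the components [w] up to orientation. The square root is the absolute value of [\det E],
    which leaves the sign; the rest is Cramer's rule for [v], the solution of [E *m v = w^T]. *)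
Lemma hodge_coframe (E : 'M[R]_2) (w : 'rV[R]_2) :
  E \in unitmx ->
  let v := invmx (E^T *m E) *m (w *m E)^T in
  Num.sqrt (\det (E^T *m E)) *: (\row_j (if j == 0 then - v 1 0 else v 0 0))
  = Num.sg (\det E) *: ((\row_j (if j == 0 then - w 0 1 else w 0 0)) *m E).
Proof.
move=> uE.
have -> : invmx (E^T *m E) *m (w *m E)^T = invmx E *m w^T.
  have uK : E^T *m E \in unitmx by rewrite unitmx_mul unitmx_tr uE.
  by rewrite trmx_mul -{1}(mulKVmx uE w^T) (mulmxA E^T) mulKmx.
have : E *m (invmx E *m w^T) = w^T by rewrite mulKVmx.
move: (invmx E *m w^T) => n En /=.
have w0 : w 0 0 = E 0 0 * n 0 0 + E 0 1 * n 1 0.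
  by have /matrixP/(_ 0 0) := En; rewrite !mxE sum2.
have w1 : w 0 1 = E 1 0 * n 0 0 + E 1 1 * n 1 0.
  by have /matrixP/(_ 1 0) := En; rewrite !mxE sum2.
rewrite det_mulmx det_tr -expr2 sqrtr_sqr normrEsg -scalerA; congr (_ *: _).
rewrite det2; apply/rowP; elim/ord2_ind; rewrite !mxE sum2 !mxE /= w0 w1; ring.
Qed.

End Algebra.

(** * Product-rule identities for the derivatives of the coordinate functions *)

Section Derivations.
Context {R : realType} {M : topologicalType}.
Implicit Types (a c : chart R M) (f u v x y : M -> R) (p q : M) (i j k : 'I_2).

Local Notation coord := Defs.coord.
Local Opaque pd.

Lemma smooth_at_continuous c p f : dom c p -> smooth_at c p f ->
  {for p, continuous f}.
Proof.
move=> cp sf; have Hp := coord_half_plane cp.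
have [h hp fh] := smooth_near_cvg Hp sf.
have cc : {for p, continuous (coord c)}.
  have := @Defs.coord_continuous _ _ c.
  rewrite continuous_open_subspace; last exact: dom_open.
  by apply; rewrite inE.
have hcc : h (coord c q) @[q --> p] --> f p.
  have hp' : h z @[z --> coord c p] --> f p by move: hp; rewrite /= coordK.
  exact: (cvg_comp _ _ cc hp').
apply: cvg_trans hcc; apply: near_eq_cvg.
have fhp : \forall q \near p, half_plane (coord c q) ->
  (f \o pt c) (coord c q) = h (coord c q) by exact: (cc _ fh).
have [W oW WE] := near_open_nbhs fhp.
apply: filterS (open_nbhs_nbhs (open_nbhsI oW (conj (@dom_open _ _ c) cp))).
move=> q [Wq cq]; rewrite -WE//= ?coordK//; exact: coord_half_plane.
Qed.

Lemma near_sg c p f : dom c p -> smooth_at c p f -> f p != 0 ->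
  \forall q \near p, Num.sg (f q) = Num.sg (f p).
Proof.
move=> cp sf; have cf := smooth_at_continuous cp sf.
rewrite neq_lt => /orP[f0|f0].
  apply: filterS (cvgr_lt (f p) cf _ f0) => q /= fq.
  by rewrite !ltr0_sg.
apply: filterS (cvgr_gt (f p) cf _ f0) => q /= fq.
by rewrite !gtr0_sg.
Qed.

(** The second derivatives of [x] are commuted so that the outer index is the one contracted with
    the vector components; they appear in that order when the metric is differentiated along the
    field. *)
Lemma pd_pairing c p x u (w0 w1 : M -> R) i : dom c p -> smooth_at c p x ->
  smooth_at c p w0 -> smooth_at c p w1 ->
  (\forall q \near p, pd c 0 x q * w0 q + pd c 1 x q * w1 q = u q) ->
  pd c i u p = pd c 0 (pd c i x) p * w0 p + pd c 0 x p * pd c i w0 p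
             + (pd c 1 (pd c i x) p * w1 p + pd c 1 x p * pd c i w1 p).
Proof.
move=> cp sx s0 s1 uE.
have sxk k : smooth_at c p (pd c k x) by exact: smooth_at_pd.
have sm0 := smooth_atM (sxk 0) s0; have sm1 := smooth_atM (sxk 1) s1.
rewrite -(pd_eq i cp uE); last exact: smooth_atD.
rewrite (pdD i cp sm0 sm1) (pdM i cp (sxk 0) s0) (pdM i cp (sxk 1) s1).
rewrite (pd_comm i 0 cp sx) (pd_comm i 1 cp sx).
have swap (r s t z : R) : r * s + t * z = z * t + r * s by ring.
by rewrite swap; congr (_ + _); exact: swap.
Qed.

Lemma pd_metric c p x y (h : M -> R) i j k : dom c p ->
  smooth_at c p x -> smooth_at c p y ->
  (\forall q \near p, pd c i x q * pd c j x q + pd c i y q * pd c j y q = h q) ->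
  pd c k h p = pd c i x p * pd c k (pd c j x) p + pd c j x p * pd c k (pd c i x) p
    + (pd c i y p * pd c k (pd c j y) p + pd c j y p * pd c k (pd c i y) p).
Proof.
move=> cp sx sy hE.
have sxk l : smooth_at c p (pd c l x) by exact: smooth_at_pd.
have syk l : smooth_at c p (pd c l y) by exact: smooth_at_pd.
have sm0 := smooth_atM (sxk i) (sxk j); have sm1 := smooth_atM (syk i) (syk j).
rewrite -(pd_eq k cp hE); last exact: smooth_atD.
by rewrite pdD// !pdM.
Qed.

(** In invariant form: d(r u dx + s v dy) = r du /\ dx + s dv /\ dy, since d dx = d dy = 0. It
    serves both for the form itself and for its Hodge star, the latter with [x] and [y]
    exchanged. *)
Lemma pd_wedge c p x y u v (h : 'I_2 -> M -> R) (r s : R) : dom c p ->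
  smooth_at c p x -> smooth_at c p y -> smooth_at c p u -> smooth_at c p v ->
  (forall j, \forall q \near p,
     r * (u q * pd c j x q) + s * (v q * pd c j y q) = h j q) ->
  pd c 0 (h 1) p - pd c 1 (h 0) p =
  r * (pd c 0 u p * pd c 1 x p - pd c 1 u p * pd c 0 x p)
  + s * (pd c 0 v p * pd c 1 y p - pd c 1 v p * pd c 0 y p).
Proof.
move=> cp sx sy su sv hE.
have sxj j : smooth_at c p (pd c j x) by exact: smooth_at_pd.
have syj j : smooth_at c p (pd c j y) by exact: smooth_at_pd.
have sux j := smooth_atM su (sxj j); have svy j := smooth_atM sv (syj j).
have cr := smooth_at_cst c p r; have cs := smooth_at_cst c p s.
have sr j := smooth_atM cr (sux j); have ss j := smooth_atM cs (svy j).
have E i j : pd c i (h j) p =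
    r * (u p * pd c i (pd c j x) p + pd c j x p * pd c i u p)
    + s * (v p * pd c i (pd c j y) p + pd c j y p * pd c i v p).
  rewrite -(pd_eq i cp (hE j)); last exact: smooth_atD.
  rewrite (pdD i cp (sr j) (ss j)) (pdM i cp cr (sux j)) (pdM i cp cs (svy j)).
  rewrite (pdM i cp su (sxj j)) (pdM i cp sv (syj j)) (pd_cst i r cp) (pd_cst i s cp).
  by rewrite !mulr0 !addr0.
rewrite (E 0 1) (E 1 0) (pd_comm 1 0 cp sx) (pd_comm 1 0 cp sy).
have expand (u0 x01 x1 d0u v0 y01 y1 d0v x0 d1u y0 d1v : R) :
  r * (u0 * x01 + x1 * d0u) + s * (v0 * y01 + y1 * d0v)
  - (r * (u0 * x01 + x0 * d1u) + s * (v0 * y01 + y0 * d1v)) =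
  r * (d0u * x1 - d1u * x0) + s * (d0v * y1 - d1v * y0) by ring.
exact: expand.
Qed.

Lemma differential_chain a c p f : dom a p -> dom c p ->
  (forall i, smooth_at a p (fun q => coord c q 0 i)) ->
  smooth_at a p f -> smooth_at c p f ->
  differential a f p = differential c f p *m Jac a c p.
Proof.
move=> ap cp sc sfa sfc; apply/rowP => j; rewrite !mxE (pd_chain j ap cp sc sfa sfc).
by apply: eq_bigr => i _; rewrite [differential _ _ _ _ _]mxE.
Qed.

Lemma coframeE c x y p i j :
  coframe c x y p i j = pd c j (if i == 0 then x else y) p.
Proof. by rewrite !mxE; case: ifP; rewrite mxE. Qed.

Lemma coframe_chain a c p x y : dom a p -> dom c p ->
  (forall i, smooth_at a p (fun q => coord c q 0 i)) ->
  smooth_at a p x -> smooth_at c p x -> smooth_at a p y -> smooth_at c p y ->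
  coframe a x y p = coframe c x y p *m Jac a c p.
Proof.
move=> ap cp sc xa xc ya yc; apply/matrixP => i j; rewrite coframeE !mxE.
under eq_bigr do rewrite coframeE.
by case: ifP => _; exact: pd_chain.
Qed.

Lemma smooth_at_coframe c p x y : dom c p -> smooth_at c p x -> smooth_at c p y ->
  smooth_mx_at c p (coframe c x y).
Proof.
move=> cp sx sy i j; under eq_fun do rewrite coframeE.
by case: ifP => _; exact: smooth_at_pd.
Qed.

End Derivations.

(** * Change of chart *)

Section Surfaces.
Context {R : realType} {M : topologicalType} {S : surface R M}.
Implicit Types (a b c : chart R M) (f x y : M -> R) (p q : M) (i j k : 'I_2).
Implicit Types (g T : M -> 'M[R]_2) (xi : M -> 'cV[R]_2) (alpha : M -> 'rV[R]_2).

Local Notation coord := Defs.coord.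
Local Opaque pd.

Lemma smooth_at_coord a c p i : atlas S a -> atlas S c -> dom a p -> dom c p ->
  smooth_at a p (fun q => coord c q 0 i).
Proof.
move=> Sa Sc ap cp.
exact: smooth_in_at (@dom_open _ _ c) (transition_smooth Sa Sc i) cp ap.
Qed.

Lemma Jac_comp a b c p : atlas S a -> atlas S b -> atlas S c ->
  dom a p -> dom b p -> dom c p -> Jac b c p = Jac a c p *m Jac b a p.
Proof.
move=> Sa Sb Sc ap bp cp; apply/matrixP => i j; rewrite [LHS]mxE [RHS]mxE.
rewrite (pd_chain j bp ap (fun k => smooth_at_coord k Sb Sa bp ap)).
- by apply: eq_bigr => k _; rewrite [Jac a c p i k]mxE.
- exact: smooth_at_coord.
- exact: smooth_at_coord.
Qed.

Lemma to_from_chart c p : atlas S c -> dom c p ->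
  to_chart S c p *m from_chart S c p = 1%:M.
Proof.
move=> Sc cp; rewrite /to_chart /from_chart -Jac_comp ?Jac_id//.
- exact: chart_at_atlas.
- exact: chart_at_dom.
Qed.

Lemma from_to_chart c p : atlas S c -> dom c p ->
  from_chart S c p *m to_chart S c p = 1%:M.
Proof. by move=> Sc cp; apply: mulmx1C; exact: to_from_chart. Qed.

Lemma to_chart_unit c p : atlas S c -> dom c p -> to_chart S c p \in unitmx.
Proof. by move=> Sc cp; have [] := mulmx1_unit (to_from_chart Sc cp). Qed.

Lemma from_chart_unit c p : atlas S c -> dom c p -> from_chart S c p \in unitmx.
Proof. by move=> Sc cp; have [] := mulmx1_unit (to_from_chart Sc cp). Qed.

Lemma from_chart_Jac a c p : atlas S a -> atlas S c -> dom a p -> dom c p ->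
  from_chart S a p = from_chart S c p *m Jac a c p.
Proof.
move=> Sa Sc ap cp; rewrite /from_chart (Jac_comp Sc)//.
- exact: chart_at_atlas.
- exact: chart_at_dom.
Qed.

Lemma bilin_in_Jac g a c p : atlas S a -> atlas S c -> dom a p -> dom c p ->
  bilin_in S a g p = (Jac a c p)^T *m bilin_in S c g p *m Jac a c p.
Proof.
move=> Sa Sc ap cp; rewrite /bilin_in (from_chart_Jac Sa Sc)//.
by rewrite trmx_mul !mulmxA.
Qed.

Lemma invmx_bilin_in g c p : atlas S c -> dom c p -> g p \in unitmx ->
  invmx (bilin_in S c g p) = to_chart S c p *m invmx (g p) *m (to_chart S c p)^T.
Proof.
move=> Sc cp gp; have ft := from_to_chart Sc cp.
have uP : bilin_in S c g p \in unitmx.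
  by rewrite /bilin_in !unitmx_mul unitmx_tr from_chart_unit// gp.
rewrite -[RHS](mulmxK uP) -[LHS]mul1mx; congr (_ *m _).
rewrite /bilin_in !mulmxA -(mulmxA _ (to_chart S c p)^T) -trmx_mul ft trmx1 mulmx1.
by rewrite mulmxKV// to_from_chart.
Qed.

(** The field on the left is the candidate preimage of [alpha]. It is defined through the preferred
    charts, which vary with the point; in a fixed chart its smoothness becomes visible. *)
Lemma vec_in_sharp g T alpha c p : atlas S c -> dom c p -> g p \in unitmx ->
  vec_in S c (fun q => T q *m (invmx (g q) *m (alpha q)^T)) p =
  endo_in S c T p *m (invmx (bilin_in S c g p) *m (form_in S c alpha p)^T).
Proof.
move=> Sc cp gp; have ft := from_to_chart Sc cp.
rewrite invmx_bilin_in// /vec_in /endo_in /form_in trmx_mul !mulmxA.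
rewrite -(mulmxA _ (to_chart S c p)^T) -trmx_mul ft trmx1 mulmx1.
by rewrite -(mulmxA _ (from_chart S c p)) ft mulmx1.
Qed.

Lemma form_in_reflect_flat g T xi c p : atlas S c -> dom c p ->
  form_in S c (reflect_flat g T xi) p =
  (endo_in S c T p *m vec_in S c xi p)^T *m bilin_in S c g p.
Proof.
move=> Sc cp; have ft := from_to_chart Sc cp.
have -> : endo_in S c T p *m vec_in S c xi p = to_chart S c p *m (T p *m xi p).
  rewrite /endo_in /vec_in !mulmxA.
  by rewrite -(mulmxA _ (from_chart S c p) (to_chart S c p)) ft mulmx1.
rewrite /form_in /reflect_flat /bilin_in [in RHS]trmx_mul !mulmxA.
by rewrite -(mulmxA _ (to_chart S c p)^T) -trmx_mul ft trmx1 mulmx1.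
Qed.

(* The function dx(xi); it does not depend on the chart used to compute it. *)
Definition frame_component x xi q : R :=
  (differential (chart_at S q) x q *m xi q) 0 0.

Lemma frame_componentE x xi c q : atlas S c -> dom c q ->
  (forall a, atlas S a -> dom a q -> smooth_at a q x) ->
  pd c 0 x q * vec_in S c xi q 0 0 + pd c 1 x q * vec_in S c xi q 1 0
  = frame_component x xi q.
Proof.
move=> Sc cq sx; have Sa := chart_at_atlas S q; have aq := chart_at_dom S q.
rewrite /frame_component (differential_chain aq cq _ (sx _ Sa aq) (sx _ Sc cq)).
  by rewrite -mulmxA [RHS]mxE sum2 ![differential _ _ _ _ _]mxE.
by move=> i; exact: smooth_at_coord.
Qed.

(** [hodge1] is computed in the preferred chart at [q]. Passing to [c] multiplies the coframe by a
    Jacobian of positive determinant, so the sign is unchanged; this is where the orientation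
    enters. *)
Lemma hodge1_coframe g alpha c q (C : 'M[R]_2) (w : 'rV[R]_2) : oriented S ->
  atlas S c -> dom c q -> C \in unitmx -> bilin_in S c g q = C^T *m C ->
  form_in S c alpha q = w *m C ->
  form_in S c (hodge1 g alpha) q =
  Num.sg (\det C) *: ((\row_j (if j == 0 then - w 0 1 else w 0 0)) *m C).
Proof.
move=> Sor Sc cq uC gC aC.
have tf := to_from_chart Sc cq; have ft := from_to_chart Sc cq.
pose E := C *m to_chart S c q.
have uE : E \in unitmx by rewrite unitmx_mul uC to_chart_unit.
have gE : g q = E^T *m E.
  rewrite /E trmx_mul -mulmxA (mulmxA C^T) -gC /bilin_in !mulmxA -trmx_mul ft.
  by rewrite trmx1 mul1mx -mulmxA ft mulmx1.
have aE : alpha q = w *m E.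
  by rewrite /E mulmxA -aC /form_in -mulmxA ft mulmx1.
rewrite /form_in /hodge1 gE aE hodge_coframe// -scalemxAl -mulmxA.
rewrite {2}/E -mulmxA tf mulmx1; congr (_ *: _).
rewrite det_mulmx sgrM (gtr0_sg (x := \det (to_chart S c q))) ?mulr1//.
by apply: Sor => //; [exact: chart_at_atlas | exact: chart_at_dom].
Qed.

Lemma smooth_vec_in xi c p : vector_fields S xi -> atlas S c -> dom c p ->
  smooth_mx_at c p (vec_in S c xi).
Proof.
move=> Xxi Sc cp i j; rewrite ord1.
exact: smooth_in_at openT (Xxi c i Sc) I cp.
Qed.

Lemma smooth_form_in alpha c p : one_forms S alpha -> atlas S c -> dom c p ->
  smooth_mx_at c p (form_in S c alpha).
Proof.
move=> Oa Sc cp i j; rewrite ord1.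
exact: smooth_in_at openT (Oa c j Sc) I cp.
Qed.

End Surfaces.

Lemma mulmx_sym_entry (R : realType) (A C : 'M[R]_2) (i j : 'I_2) :
  (A^T *m C + C^T *m A) i j =
  A 0 i * C 0 j + A 1 i * C 1 j + (C 0 i * A 0 j + C 1 i * A 1 j).
Proof. by rewrite !mxE !sum2 !mxE. Qed.

(** * The Cauchy-Riemann equations in adapted coordinates *)

Section EuclideanCoordinates.
Context {R : realType} {M : topologicalType} {S : surface R M}.
Context {g T : M -> 'M[R]_2} {U : set M} {x y : M -> R}.
Implicit Types (a c : chart R M) (p q : M) (i j k : 'I_2) (xi : M -> 'cV[R]_2).

Local Opaque pd.

Let D : 'M[R]_2 := diag_mx (\row_j (if j == 0 then 1 else -1)).

(** The local condition on a reflection in matrix form: the outer products of coordinate fields and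
    differentials are replaced by a conjugate of [D], so that the later steps are matrix algebra. *)
Definition euclidean_reflection_on := local_coordinates S U x y /\
  forall c q, atlas S c -> U q -> dom c q ->
    bilin_in S c g q = (coframe c x y q)^T *m coframe c x y q /\
    endo_in S c T q = invmx (coframe c x y q) *m D *m coframe c x y q.

Context (er : euclidean_reflection_on).

Let oU : open U. Proof. by case: er => -[]. Qed.

Lemma coordinate_smooth_x c q : atlas S c -> U q -> dom c q -> smooth_at c q x.
Proof. by move=> Sc; case: er => -[_ /(_ c Sc)[sx _] _ _] _; exact: smooth_in_at. Qed.

Lemma coordinate_smooth_y c q : atlas S c -> U q -> dom c q -> smooth_at c q y.
Proof. by move=> Sc; case: er => -[_ /(_ c Sc)[_ sy] _ _] _; exact: smooth_in_at. Qed.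

Lemma coframe_unit c q : atlas S c -> U q -> dom c q -> coframe c x y q \in unitmx.
Proof. by move=> Sc Uq cq; case: er => -[_ _ _ +] _; exact. Qed.

Lemma bilin_in_coframe c q : atlas S c -> U q -> dom c q ->
  bilin_in S c g q = (coframe c x y q)^T *m coframe c x y q.
Proof. by move=> Sc Uq cq; case: er => _ /(_ c q Sc Uq cq)[]. Qed.

Lemma bilin_in_unit c q : atlas S c -> U q -> dom c q ->
  bilin_in S c g q \in unitmx.
Proof.
by move=> Sc Uq cq; rewrite bilin_in_coframe// unitmx_mul unitmx_tr coframe_unit.
Qed.

Lemma near_coordinates c p (P : set M) : U p -> dom c p ->
  (forall q, U q -> dom c q -> P q) -> \forall q \near p, P q.
Proof.
move=> Up cp UP.
have oUc := open_nbhsI (conj oU Up) (conj (@dom_open _ _ c) cp).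
by apply: filterS (open_nbhs_nbhs oUc) => q [Uq cq]; exact: UP.
Qed.

Lemma bilin_in_entry c q i j : atlas S c -> U q -> dom c q ->
  bilin_in S c g q i j = pd c i x q * pd c j x q + pd c i y q * pd c j y q.
Proof.
move=> Sc Uq cq; rewrite bilin_in_coframe// mxE sum2.
by rewrite ![_^T _ _]mxE !coframeE.
Qed.

Context {xi : M -> 'cV[R]_2} (Xxi : vector_fields S xi).
Let u := frame_component (S := S) x xi.
Let v := frame_component (S := S) y xi.

Lemma frame_component_x c q : atlas S c -> U q -> dom c q ->
  pd c 0 x q * vec_in S c xi q 0 0 + pd c 1 x q * vec_in S c xi q 1 0 = u q.
Proof.
move=> Sc Uq cq; apply: frame_componentE => // a Sa; exact: coordinate_smooth_x.
Qed.

Lemma frame_component_y c q : atlas S c -> U q -> dom c q ->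
  pd c 0 y q * vec_in S c xi q 0 0 + pd c 1 y q * vec_in S c xi q 1 0 = v q.
Proof.
move=> Sc Uq cq; apply: frame_componentE => // a Sa; exact: coordinate_smooth_y.
Qed.

Lemma near_frame_component_x c p : atlas S c -> U p -> dom c p ->
  \forall q \near p, pd c 0 x q * vec_in S c xi q 0 0
                   + pd c 1 x q * vec_in S c xi q 1 0 = u q.
Proof.
by move=> Sc Up cp; apply: near_coordinates cp _ => // q; exact: frame_component_x.
Qed.

Lemma near_frame_component_y c p : atlas S c -> U p -> dom c p ->
  \forall q \near p, pd c 0 y q * vec_in S c xi q 0 0
                   + pd c 1 y q * vec_in S c xi q 1 0 = v q.
Proof.
by move=> Sc Up cp; apply: near_coordinates cp _ => // q; exact: frame_component_y.
Qed.

Lemma smooth_frame_component_x c p : atlas S c -> U p -> dom c p -> smooth_at c p u.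
Proof.
move=> Sc Up cp; apply: smooth_at_eq (near_frame_component_x Sc Up cp) _ => //.
have sx := coordinate_smooth_x Sc Up cp; have sxi := smooth_vec_in Xxi Sc cp.
by apply: smooth_atD; apply: smooth_atM; try exact: sxi; exact: smooth_at_pd.
Qed.

Lemma smooth_frame_component_y c p : atlas S c -> U p -> dom c p -> smooth_at c p v.
Proof.
move=> Sc Up cp; apply: smooth_at_eq (near_frame_component_y Sc Up cp) _ => //.
have sy := coordinate_smooth_y Sc Up cp; have sxi := smooth_vec_in Xxi Sc cp.
by apply: smooth_atD; apply: smooth_atM; try exact: sxi; exact: smooth_at_pd.
Qed.

(** The Lie derivative commutes with d, so L_xi dx = d(dx(xi)) = du and likewise for y; the Leibniz
    rule applied to dx dx + dy dy gives the formula. In components, the second derivatives of [x]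
    and [y] match once they are commuted. *)
Lemma lie_metric_coframe c p : atlas S c -> U p -> dom c p ->
  lie_metric S g xi c p = (coframe c u v p)^T *m coframe c x y p
                        + (coframe c x y p)^T *m coframe c u v p.
Proof.
move=> Sc Up cp; apply/matrixP => i j; rewrite mulmx_sym_entry !coframeE /=.
have sx := coordinate_smooth_x Sc Up cp; have sy := coordinate_smooth_y Sc Up cp.
have sxi := smooth_vec_in Xxi Sc cp.
have Dg k : pd c k (fun q => bilin_in S c g q i j) p =
    pd c i x p * pd c k (pd c j x) p + pd c j x p * pd c k (pd c i x) p
    + (pd c i y p * pd c k (pd c j y) p + pd c j y p * pd c k (pd c i y) p).
  apply: pd_metric => //; apply: near_coordinates cp _ => // q Uq cq.
  by rewrite bilin_in_entry.
have Du k := pd_pairing k cp sx (sxi 0 0) (sxi 1 0) (near_frame_component_x Sc Up cp).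
have Dv k := pd_pairing k cp sy (sxi 0 0) (sxi 1 0) (near_frame_component_y Sc Up cp).
rewrite (Du i) (Du j) (Dv i) (Dv j) mxE sum2 (Dg 0) (Dg 1).
rewrite !(bilin_in_entry _ _ Sc Up cp).
have expand (w0 w1 Xi Xj Yi Yj x0 x1 y0 y1 : R)
    (X0i X0j X1i X1j Y0i Y0j Y1i Y1j Di0 Di1 Dj0 Dj1 : R) :
  w0 * (Xi * X0j + Xj * X0i + (Yi * Y0j + Yj * Y0i))
  + (x0 * Xj + y0 * Yj) * Di0 + (Xi * x0 + Yi * y0) * Dj0
  + (w1 * (Xi * X1j + Xj * X1i + (Yi * Y1j + Yj * Y1i))
  + (x1 * Xj + y1 * Yj) * Di1 + (Xi * x1 + Yi * y1) * Dj1) =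
  (X0i * w0 + x0 * Di0 + (X1i * w1 + x1 * Di1)) * Xj
  + (Y0i * w0 + y0 * Di0 + (Y1i * w1 + y1 * Di1)) * Yj
  + (Xi * (X0j * w0 + x0 * Dj0 + (X1j * w1 + x1 * Dj1))
  + Yi * (Y0j * w0 + y0 * Dj0 + (Y1j * w1 + y1 * Dj1))) by ring.
exact: expand.
Qed.

(** Tensoriality of the Lie derivative, read off from the coframe expression because both coframes
    transform by the same Jacobian. It makes the conformal factor independent of the chart. *)
Lemma lie_metric_Jac a c p : atlas S a -> atlas S c -> U p -> dom a p -> dom c p ->
  lie_metric S g xi a p = (Jac a c p)^T *m lie_metric S g xi c p *m Jac a c p.
Proof.
move=> Sa Sc Up ap cp; rewrite !lie_metric_coframe//.
have sc i := smooth_at_coord i Sa Sc ap cp.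
rewrite (coframe_chain ap cp sc (coordinate_smooth_x Sa Up ap)
  (coordinate_smooth_x Sc Up cp) (coordinate_smooth_y Sa Up ap)
  (coordinate_smooth_y Sc Up cp)).
rewrite (coframe_chain ap cp sc (smooth_frame_component_x Sa Up ap)
  (smooth_frame_component_x Sc Up cp) (smooth_frame_component_y Sa Up ap)
  (smooth_frame_component_y Sc Up cp)).
by rewrite !trmx_mul mulmxDr mulmxDl !mulmxA.
Qed.

Let alpha := reflect_flat g T xi.
Let w q : 'rV[R]_2 := \row_j (if j == 0 then u q else - v q).

Lemma form_in_coframe c q : atlas S c -> U q -> dom c q ->
  form_in S c alpha q = w q *m coframe c x y q.
Proof.
move=> Sc Uq cq; rewrite form_in_reflect_flat//.
have [_ /(_ c q Sc Uq cq)[-> ->]] := er.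
have uC := coframe_unit Sc Uq cq.
have := frame_component_x Sc Uq cq; have := frame_component_y Sc Uq cq.
rewrite mulmxA -trmx_mul -!(mulmxA (invmx _)) mulKVmx// => vE uE.
have DE (A : 'M[R]_2) i j : (D *m A) i j = (if i == 0 then 1 else -1) * A i j.
  by rewrite mul_diag_mx [LHS]mxE [X in X * _]mxE.
congr (_ *m _); apply/rowP; elim/ord2_ind.
  by rewrite 2![LHS]mxE [RHS]mxE /= -uE sum2 !DE !coframeE /= !mul1r.
rewrite 2![LHS]mxE [RHS]mxE /= -vE sum2 !DE !coframeE /=.
by rewrite !mulN1r !mulNr -opprD.
Qed.

Lemma ext_deriv_reflect_flat c p : atlas S c -> U p -> dom c p ->
  ext_deriv S c alpha p =
  pd c 0 u p * pd c 1 x p - pd c 1 u p * pd c 0 x p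
  - (pd c 0 v p * pd c 1 y p - pd c 1 v p * pd c 0 y p).
Proof.
move=> Sc Up cp.
have := @pd_wedge _ _ c p x y u v (fun j q => form_in S c alpha q 0 j) 1 (-1) cp.
rewrite mul1r mulN1r; apply.
- exact: coordinate_smooth_x.
- exact: coordinate_smooth_y.
- exact: smooth_frame_component_x.
- exact: smooth_frame_component_y.
move=> j; apply: near_coordinates cp _ => // q Uq cq.
by rewrite form_in_coframe// [RHS]mxE sum2 !coframeE !mxE /= mul1r mulN1r mulNr.
Qed.

Lemma codiff_reflect_flat c p : oriented S -> atlas S c -> U p -> dom c p ->
  codiff S g c alpha p = 0 <->
  pd c 0 u p * pd c 1 y p - pd c 1 u p * pd c 0 y p
  + (pd c 0 v p * pd c 1 x p - pd c 1 v p * pd c 0 x p) = 0.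
Proof.
move=> Sor Sc Up cp.
have d0 : \det (coframe c x y p) != 0.
  by rewrite -unitfE -unitmxE coframe_unit.
have sx := coordinate_smooth_x Sc Up cp; have sy := coordinate_smooth_y Sc Up cp.
set s := Num.sg (\det (coframe c x y p)).
have s0 : s != 0 by rewrite sgr_eq0.
have nsg := near_sg cp (smooth_at_det (smooth_at_coframe cp sx sy)) d0.
have E : ext_deriv S c (hodge1 g alpha) p =
    s * (pd c 0 u p * pd c 1 y p - pd c 1 u p * pd c 0 y p)
    + s * (pd c 0 v p * pd c 1 x p - pd c 1 v p * pd c 0 x p).
  (* The star of u dx - v dy is s (u dy + v dx), so the two coordinates exchange roles and both
     coefficients equal the sign [s]. *)
  apply: (@pd_wedge _ _ c p y x u v
    (fun j q => form_in S c (hodge1 g alpha) q 0 j)) => //.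
  - exact: smooth_frame_component_x.
  - exact: smooth_frame_component_y.
  have [W oW WE] := near_open_nbhs nsg.
  have oWU := open_nbhsI oW (open_nbhsI (conj oU Up) (conj (@dom_open _ _ c) cp)).
  move=> j; apply: filterS (open_nbhs_nbhs oWU) => q [Wq [Uq cq]].
  rewrite (hodge1_coframe Sor Sc cq (coframe_unit Sc Uq cq)
    (bilin_in_coframe Sc Uq cq) (form_in_coframe Sc Uq cq)).
  rewrite (WE q Wq) -/s [RHS]mxE [X in _ = _ * X]mxE sum2 !coframeE !mxE /= opprK.
  by rewrite addrC mulrDr.
have b0 : Num.sqrt (\det (bilin_in S c g p)) != 0.
  by rewrite bilin_in_coframe// det_mulmx det_tr -expr2 sqrtr_sqr normr_eq0.
rewrite /codiff /hodge2 E -mulrDr; split=> [/eqP|->].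
  rewrite oppr_eq0 mulf_eq0 invr_eq0 (negPf b0) orbF mulf_eq0 (negPf s0) /=.
  by move/eqP.
by rewrite mulr0 mul0r oppr0.
Qed.

(** Here the factor is merely a number at the point [p]; that these numbers form a smooth function
    is settled in the final proof. *)
Lemma conformal_iff_harmonic_at c p : oriented S -> atlas S c -> U p -> dom c p ->
  (exists F, lie_metric S g xi c p = F *: bilin_in S c g p) <->
  ext_deriv S c alpha p = 0 /\ codiff S g c alpha p = 0.
Proof.
move=> Sor Sc Up cp.
rewrite codiff_reflect_flat// ext_deriv_reflect_flat// lie_metric_coframe//.
rewrite bilin_in_coframe// conformal_iff_wedge ?coframe_unit// !coframeE /=.
by [].
Qed.

End EuclideanCoordinates.

(** * From the local equivalence to the equality of the two spaces *)

Lemma euclidean_reflection_cover (R : realType) (M : topologicalType)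
    (S : surface R M) (g T : M -> 'M[R]_2) : orthogonal_reflection S g T ->
  forall p, exists U x y, U p /\ @euclidean_reflection_on R M S g T U x y.
Proof.
move=> [_ _ _ cov] p; have [U [x [y [Up lc E]]]] := cov p.
exists U, x, y; split=> //; split=> // c q Sc Uq cq.
have [-> ->] := E c q Sc Uq cq.
have uC : coframe c x y q \in unitmx by case: lc => _ _ _; exact.
set C := coframe c x y q.
have rx j : C 0 j = differential c x q 0 j by rewrite mxE.
have ry j : C 1 j = differential c y q 0 j by rewrite mxE.
split; apply/matrixP => i j.
  by rewrite mxE [RHS]mxE sum2 !mxE !big_ord1 !mxE.
rewrite [RHS]mxE sum2 mul_mx_diag [LHS]mxE [X in _ + X]mxE ![(_ *m _) i j]mxE.
rewrite !big_ord1 -rx -ry [col 0 _ _ _]mxE [col 1 _ _ _]mxE.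
by rewrite ![(\matrix_(_, _) _) i _]mxE ![(\row__ _) _ _]mxE /= mulr1 mulrN1 mulNr.
Qed.

Theorem lemma4p1 (R : realType) (M : topologicalType) (S : surface R M)
    (M_compact : compact [set: M]) (S_oriented : oriented S)
    (g : M -> 'M[R]_2) (g_metric : riemannian_metric S g)
    (g_flat : flat S g)
    (T : M -> 'M[R]_2) (T_reflection : orthogonal_reflection S g T) :
  reflect_flat g T @` conformal_fields S g = harmonic_1fields S g.
Proof.
have cover := euclidean_reflection_cover T_reflection.
have [T_smooth _ T_invol _] := T_reflection.
have [g_sym _ g_smooth] := g_metric.
have bU c p : atlas S c -> dom c p -> bilin_in S c g p \in unitmx.
  move=> Sc cp; have [U [x [y [Up er]]]] := cover p.
  exact: (bilin_in_unit er).
have gU p : g p \in unitmx.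
  have := bU _ p (chart_at_atlas S p) (chart_at_dom S p).
  by rewrite /bilin_in !unitmx_mul => /andP[/andP[_ ->]].
have sg c p : atlas S c -> dom c p -> smooth_mx_at c p (bilin_in S c g).
  by move=> Sc cp i j; exact: smooth_in_at openT (g_smooth c i j Sc) I cp.
have sT c p : atlas S c -> dom c p -> smooth_mx_at c p (endo_in S c T).
  by move=> Sc cp i j; exact: smooth_in_at openT (T_smooth c i j Sc) I cp.
have near_dom c p (P : set M) : dom c p -> (forall q, dom c q -> P q) ->
    \forall q \near p, P q.
  by move=> cp dP; exact: filterS dP (open_nbhs_nbhs (conj (@dom_open _ _ c) cp)).
apply/seteqP; split=> [_ [xi [Xxi [F sF LF]] <-]|alpha [Oa Ha]].
  split.
    move=> c i Sc; apply: smooth_at_in => p cp.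
    apply: (@smooth_at_eq _ _ c p (fun q =>
      ((endo_in S c T q *m vec_in S c xi q)^T *m bilin_in S c g q) 0 i)) => //.
      by apply: near_dom cp _ => q cq; rewrite form_in_reflect_flat.
    apply: smooth_at_mulmx; last exact: sg.
    apply: smooth_at_trmx; apply: smooth_at_mulmx; first exact: sT.
    exact: smooth_vec_in.
  move=> c p Sc cp; have [U [x [y [Up er]]]] := cover p.
  apply/(conformal_iff_harmonic_at er Xxi S_oriented Sc Up cp).
  by exists (F p); exact: LF.
(* As [T] is an involution and g is invertible, this is the only field that [reflect_flat] can send
   to [alpha]. *)
pose xi q := T q *m (invmx (g q) *m (alpha q)^T).
have Xxi : vector_fields S xi.
  move=> c i Sc; apply: smooth_at_in => p cp.
  apply: (@smooth_at_eq _ _ c p (fun q => (endo_in S c T q *m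
      (invmx (bilin_in S c g q) *m (form_in S c alpha q)^T)) i 0)) => //.
    by apply: near_dom cp _ => q cq; rewrite vec_in_sharp.
  apply: smooth_at_mulmx; first exact: sT.
  apply: smooth_at_mulmx; last by apply: smooth_at_trmx; exact: smooth_form_in.
  apply: smooth_at_invmx => //; first exact: sg.
  by apply: near_dom cp _ => q; exact: bU.
have xiE : reflect_flat g T xi = alpha.
  apply/funext => p; rewrite /reflect_flat /xi mulmxA T_invol mul1mx.
  by rewrite trmx_mul trmxK trmx_inv g_sym mulmxKV.
exists xi => //; split=> //.
(* If L_xi g = F g then g^-1 L_xi g = F times the identity, of trace 2 F. Unlike the mere existence
   of F at each point, this formula shows smoothness. *)
pose G c q := 2^-1 * \tr (invmx (bilin_in S c g q) *m lie_metric S g xi c q).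
have conf c p : atlas S c -> dom c p ->
    lie_metric S g xi c p = G c p *: bilin_in S c g p.
  move=> Sc cp; have [U [x [y [Up er]]]] := cover p.
  have [F LF] : exists F, lie_metric S g xi c p = F *: bilin_in S c g p.
    apply/(conformal_iff_harmonic_at er Xxi S_oriented Sc Up cp).
    by rewrite xiE; exact: Ha.
  by rewrite /G LF -scalemxAr mulVmx ?bU// mxtraceZ mxtrace1 mulrCA mulVf ?mulr1.
(* The preferred chart need not vary smoothly with the point, so smoothness of [F] rests on its
   agreement with [G c] throughout the domain of each fixed chart [c]. *)
pose F q := G (chart_at S q) q.
have FE c p : atlas S c -> dom c p -> G c p = F p.
  move=> Sc cp; have [U [x [y [Up er]]]] := cover p.
  have Sa := chart_at_atlas S p; have ap := chart_at_dom S p.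
  have LF : lie_metric S g xi c p = F p *: bilin_in S c g p.
    (* Both L_xi g and g transform by the same congruence, so a factor found in the preferred chart
       is also the factor in [c]. *)
    rewrite (bilin_in_Jac g Sc Sa cp ap) scalemxAl scalemxAr.
    apply: etrans (lie_metric_Jac er Xxi Sc Sa Up cp ap) _.
    by congr (_ *m _ *m _); exact: conf.
  rewrite /G LF -scalemxAr mulVmx ?bU// mxtraceZ mxtrace1 mulrCA.
  by rewrite mulVf ?mulr1.
exists F; last by move=> c p Sc cp; rewrite -(FE c p Sc cp); exact: conf.
move=> c Sc; apply: smooth_at_in => p cp.
apply: (@smooth_at_eq _ _ c p (G c)) => //.
  by apply: near_dom cp _ => q cq; exact: FE.
apply: smooth_atM; first exact: smooth_at_cst.
rewrite /mxtrace; apply: smooth_at_sum => i.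
apply: smooth_at_mulmx.
  apply: smooth_at_invmx => //; first exact: sg.
  by apply: near_dom cp _ => q; exact: bU.
move=> {}i j; under eq_fun do rewrite mxE.
apply: smooth_at_sum => k.
have sv := smooth_vec_in Xxi Sc cp; have sb := sg c p Sc cp.
apply: smooth_atD; first apply: smooth_atD.
- by apply: smooth_atM; [exact: sv | exact/smooth_at_pd/sb].
- by apply: smooth_atM; [exact: sb | exact/smooth_at_pd/sv].
- by apply: smooth_atM; [exact: sb | exact/smooth_at_pd/sv].
Qed.
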